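(* Let $\mathbb{E}_{4^d}=\mathbb{Z}_4[x]/\langle g_4\rangle$, where $g_2\in\mathbb{Z}_2[x]$ is irreducible of degree $d\ge 1$ and $g_4=\overline{g_2}\in\mathbb{Z}_4[x]$. There is a randomized algorithm that correctly computes the permanent of a given matrix $M\in\mathbb{E}_{4^d}^{n\times n}$ in $\tilde O(n^{2+\omega}d)$ time and with probability at least $1-2^{1-d}n^3$.
   Context: $\mathbb{Z}_m$ denotes the ring of integers modulo $m$. The lift $\overline{g_2}\in\mathbb{Z}_4[x]$ of $g_2\in\mathbb{Z}_2[x]$ is obtained by regarding the $\{0,1\}$-reduced coefficients of $g_2$ as elements $0,1$ of $\mathbb{Z}_4$. The polynomial $g_2$ is assumed available for arithmetic; arithmetic operations in $\mathbb{E}_{4^d}$ and in $\mathbb{F}_{2^d}=\mathbb{Z}_2[x]/\langle g_2\rangle$ take $\tilde O(d)$ time each. The permanent of $M=(\sigma_{i,j})$ is $\operatorname{per}M=\sum_{f\in S_n}\prod_{i=1}^n\sigma_{i,f(i)}$. The notation $\tilde O(\cdot)$ suppresses polylogarithmic factors, and $\omega$ is the square matrix multiplication exponent. *)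

(* Defs.v *)
From HB Require Import structures.
From mathcomp Require Import all_boot all_order all_fingroup all_algebra all_field.
From mathcomp Require Import all_classical all_reals all_analysis.

Set Implicit Arguments.
Unset Strict Implicit.
Unset Printing Implicit Defensive.
Import Order.TTheory GRing.Theory Num.Theory.
Local Open Scope ring_scope.

Definition permanent (R : comNzRingType) (n : nat) (M : 'M[R]_n) : R :=
  \sum_(s : 'S_n) \prod_(i < n) M i (s i).

(* Coefficientwise {0,1}-lift from Z_2[x] to Z_4[x]; not a ring morphism. *)
Definition lift_poly (p : {poly 'F_2}) : {poly 'Z_4} :=
  map_poly (fun c : 'F_2 => (c : nat)%:R : 'Z_4) p.

Definition red_poly (p : {poly 'Z_4}) : {poly 'F_2} :=
  map_poly (fun c : 'Z_4 => (c : nat)%:R : 'F_2) p.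

(* For an irreducible g2, both g2 and its lift are monic of positive degree, so
   the {poly %/ _} below are the literal quotient rings.  The first one is
   then a field; its inverse operation is total, with 0^-1 = 0. *)
Definition F2d (g2 : {poly 'F_2}) : Type := {poly %/ g2}.
Definition E4d (g2 : {poly 'F_2}) : Type := {poly %/ lift_poly g2}.
HB.instance Definition _ (g2 : {poly 'F_2}) := Finite.on (F2d g2).
HB.instance Definition _ (g2 : {poly 'F_2}) := GRing.ComUnitRing.on (F2d g2).
HB.instance Definition _ (g2 : {poly 'F_2}) := GRing.ComNzRing.on (E4d g2).

Definition liftE (g2 : {poly 'F_2}) (y : F2d g2) : E4d g2 :=
  in_qpoly (lift_poly g2) (lift_poly (y : {poly %/ g2})).
Definition redE (g2 : {poly 'F_2}) (x : E4d g2) : F2d g2 :=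
  in_qpoly g2 (red_poly (x : {poly %/ lift_poly g2})).

(* Randomized random-access machine.  A program is a finite piece of syntax that mentions neither n, d, g2 nor the
   matrix.  It works on three unbounded memories indexed by natural numbers:
   natural numbers, elements of E_{4^d}, and elements of F_{2^d}.  Operations on
   natural numbers are charged by bit length (logarithmic cost); every
   operation on elements of the two rings, every zero test, conversion or uniform
   random draw is charged [tau] on top of the cost of its address
   expressions. *)

Inductive iexp : Type :=
| ICst of nat
| IMem of iexp
| IAdd of iexp & iexp
| ISub of iexp & iexp
| IMul of iexp & iexp.

Inductive bexp : Type :=
| BLt of iexp & iexp
| BEq of iexp & iexp
| BEzero of iexp
| BFzero of iexp
| BNot of bexp
| BAnd of bexp & bexp.

(* The first argument is always the destination address. *)
Inductive instr : Type :=
| ISet of iexp & iexp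
| EConst of iexp & bool
| EAdd of iexp & iexp & iexp
| ESub of iexp & iexp & iexp
| EMul of iexp & iexp & iexp
| FConst of iexp & bool
| FAdd of iexp & iexp & iexp
| FSub of iexp & iexp & iexp
| FMul of iexp & iexp & iexp
| FInv of iexp & iexp
| ERed of iexp & iexp
| FLift of iexp & iexp.

Inductive cmd : Type :=
| CInstr of instr
| CRand of iexp
| CSeq of cmd & cmd
| CIf of bexp & cmd & cmd
| CWhile of bexp & cmd.

(* [tape] holds the random field elements not yet consumed. *)
Record state (g2 : {poly 'F_2}) : Type := State {
  imem : nat -> nat;
  emem : nat -> E4d g2;
  fmem : nat -> F2d g2;
  tape : seq (F2d g2) }.

Definition upd (V : Type) (m : nat -> V) (a : nat) (v : V) : nat -> V :=
  fun x => if x == a then v else m x.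

Definition bits (v : nat) : nat := (trunc_log 2 v).+1.

Fixpoint ival (m : nat -> nat) (e : iexp) : nat :=
  match e with
  | ICst c => c
  | IMem a => m (ival m a)
  | IAdd e1 e2 => (ival m e1 + ival m e2)%N
  | ISub e1 e2 => (ival m e1 - ival m e2)%N
  | IMul e1 e2 => (ival m e1 * ival m e2)%N
  end.

Fixpoint icost (m : nat -> nat) (e : iexp) : nat :=
  match e with
  | ICst c => bits c
  | IMem a => (icost m a + bits (ival m e))%N
  | IAdd e1 e2 | ISub e1 e2 => (icost m e1 + icost m e2 + bits (ival m e))%N
  | IMul e1 e2 =>
      (icost m e1 + icost m e2 + bits (ival m e1) * bits (ival m e2))%N
  end.

Section Semantics.
Variables (g2 : {poly 'F_2}) (tau : nat).
Implicit Types s : state g2.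

Fixpoint bval s (b : bexp) : bool :=
  match b with
  | BLt e1 e2 => (ival (imem s) e1 < ival (imem s) e2)%N
  | BEq e1 e2 => ival (imem s) e1 == ival (imem s) e2
  | BEzero a => emem s (ival (imem s) a) == 0
  | BFzero a => fmem s (ival (imem s) a) == 0
  | BNot b1 => ~~ bval s b1
  | BAnd b1 b2 => bval s b1 && bval s b2
  end.

Fixpoint bcost s (b : bexp) : nat :=
  match b with
  | BLt e1 e2 | BEq e1 e2 => (icost (imem s) e1 + icost (imem s) e2 + 1)%N
  | BEzero a | BFzero a => (icost (imem s) a + tau + 1)%N
  | BNot b1 => (bcost s b1 + 1)%N
  | BAnd b1 b2 => (bcost s b1 + bcost s b2 + 1)%N
  end.

Definition set_imem s m := State m (emem s) (fmem s) (tape s).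
Definition set_emem s m := State (imem s) m (fmem s) (tape s).
Definition set_fmem s m := State (imem s) (emem s) m (tape s).
Definition set_tape s r := State (imem s) (emem s) (fmem s) r.

Definition step s (i : instr) : state g2 :=
  let v := ival (imem s) in
  let E a := emem s (v a) in
  let F a := fmem s (v a) in
  let setE a x := set_emem s (upd (emem s) (v a) x) in
  let setF a x := set_fmem s (upd (fmem s) (v a) x) in
  match i with
  | ISet a e => set_imem s (upd (imem s) (v a) (v e))
  | EConst a c => setE a c%:R
  | EAdd a b c => setE a (E b + E c)
  | ESub a b c => setE a (E b - E c)
  | EMul a b c => setE a (E b * E c)
  | FConst a c => setF a c%:R
  | FAdd a b c => setF a (F b + F c)
  | FSub a b c => setF a (F b - F c)
  | FMul a b c => setF a (F b * F c)
  | FInv a b => setF a (F b)^-1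
  | ERed a b => setF a (redE (E b))
  | FLift a b => setE a (liftE (F b))
  end.

Definition step_cost s (i : instr) : nat :=
  let c := icost (imem s) in
  match i with
  | ISet a e => (c a + c e + 1)%N
  | EConst a _ | FConst a _ => (c a + tau + 1)%N
  | FInv a b | ERed a b | FLift a b => (c a + c b + tau + 1)%N
  | EAdd a b d | ESub a b d | EMul a b d
  | FAdd a b d | FSub a b d | FMul a b d => (c a + c b + c d + tau + 1)%N
  end.

(* [exec p s t s']: from state s, p halts after time t in state s'.  A draw from
   an exhausted tape has no transition. *)
Inductive exec : cmd -> state g2 -> nat -> state g2 -> Prop :=
| ExInstr i s : exec (CInstr i) s (step_cost s i) (step s i)
| ExRand a s x r : tape s = x :: r ->
    exec (CRand a) s (icost (imem s) a + tau + 1)%N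
      (set_tape (set_fmem s (upd (fmem s) (ival (imem s) a) x)) r)
| ExSeq p q s1 s2 s3 t1 t2 :
    exec p s1 t1 s2 -> exec q s2 t2 s3 -> exec (CSeq p q) s1 (t1 + t2)%N s3
| ExIfT b p q s t s' : bval s b ->
    exec p s t s' -> exec (CIf b p q) s (bcost s b + t)%N s'
| ExIfF b p q s t s' : ~~ bval s b ->
    exec q s t s' -> exec (CIf b p q) s (bcost s b + t)%N s'
| ExWhileT b p s1 s2 s3 t1 t2 : bval s1 b ->
    exec p s1 t1 s2 -> exec (CWhile b p) s2 t2 s3 ->
    exec (CWhile b p) s1 (bcost s1 b + t1 + t2)%N s3
| ExWhileF b p s : ~~ bval s b -> exec (CWhile b p) s (bcost s b) s.

End Semantics.

(* Input convention: n and d in integer cells 0 and 1, and M in row-major order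
   in the E-memory; all other cells are 0. *)
Definition init (g2 : {poly 'F_2}) (n d : nat) (M : 'M[E4d g2]_n)
    (r : seq (F2d g2)) : state g2 :=
  State (fun a => if a == 0%N then n else if a == 1%N then d else 0%N)
    (fun a => nth 0 [seq M i j | i <- enum 'I_n, j <- enum 'I_n] a)
    (fun=> 0) r.

Definition halts_within (g2 : {poly 'F_2}) (tau : nat) (p : cmd) (n d : nat)
    (M : 'M[E4d g2]_n) (r : seq (F2d g2)) (t : nat) : Prop :=
  exists t' s, exec tau p (init d M r) t' s /\ (t' <= t)%N.

(* The output is read from cell 0 of the E-memory. *)
Definition outputs (g2 : {poly 'F_2}) (tau : nat) (p : cmd) (n d : nat)
    (M : 'M[E4d g2]_n) (r : seq (F2d g2)) (z : E4d g2) : Prop :=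
  exists t s, exec tau p (init d M r) t s /\ emem s 0 = z.

(* Probability of output z over L independent uniform elements of F_{2^d}. *)
Definition output_prob (R : realType) (g2 : {poly 'F_2}) (tau : nat) (p : cmd)
    (n d : nat) (M : 'M[E4d g2]_n) (L : nat) (z : E4d g2) : R :=
  #|[set r : L.-tuple (F2d g2) | `[< outputs tau p d M r z >]]|%:R
    / #|{: L.-tuple (F2d g2)}|%:R.

(* Straight-line programs: each instruction appends one value to a list that
   initially holds the inputs, and may refer to any earlier position. *)
Inductive slp_instr : Type :=
| SConst of bool
| SAdd of nat & nat
| SSub of nat & nat
| SMul of nat & nat.

Definition slp_val (K : fieldType) (v : seq K) (o : slp_instr) : K :=
  match o with
  | SConst c => c%:R
  | SAdd a b => v`_a + v`_b
  | SSub a b => v`_a - v`_b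
  | SMul a b => v`_a * v`_b
  end.

Definition slp_run (K : fieldType) (ops : seq slp_instr) (v : seq K) : seq K :=
  foldl (fun v o => rcons v (slp_val v o)) v ops.

Definition mx_entries (K : fieldType) (n : nat) (A : 'M[K]_n) : seq K :=
  [seq A i j | i <- enum 'I_n, j <- enum 'I_n].

(* All fields of characteristic 2 are considered at once: an identity over all
   of them is an identity between polynomials over Z_2 in the entries. *)
Definition slp_mulmx (n : nat) (ops : seq slp_instr)
    (out : 'I_n -> 'I_n -> nat) : Prop :=
  forall K : fieldType, 2%N \in [pchar K] ->
  forall (A B : 'M[K]_n) (i j : 'I_n),
    (slp_run ops (mx_entries A ++ mx_entries B))`_(out i j) = (A *m B) i j.

(* The exponent in characteristic 2; it is the same for every field of that
   characteristic. *)
Definition omega (R : realType) : R :=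
  inf [set e : R | exists C : R, forall n : nat, (0 < n)%N ->
         exists (ops : seq slp_instr) (out : 'I_n -> 'I_n -> nat),
           slp_mulmx ops out /\ (size ops)%:R <= C * n%:R `^ e].

(* With C and k independent of all parameters: t is in O(f log^k f).  The shift
   by 2 keeps the logarithm above 1 for f >= 1. *)
Definition softO_bound (R : realType) (C : R) (k : nat) (f t : R) : Prop :=
  t <= C * f * ln (f + 2) ^+ k.

(* Main.v *)
(** In a commutative ring with 4 = 0, let A = L U with L unit lower and U upper triangular, and
    let P be the inverse of A.  Then
      per A = det A * (1 + n - sum_(i,j,k) (L_ij U_jk P_ki)^2).
    Indeed 2 per = 2 det, so adding c times row j to row i changes the permanent by
    2 c det A sum_k (A_jk)^2 P_kj P_ki, and this is what the right-hand side changes by when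
    such operations build L from the identity.  A Gauss-Jordan sweep without pivoting yields
    L, U and P in n^3 ring operations as soon as the leading principal minors are units.

    Draw n random points x_t of the field, lift them to y_t, and evaluate the permanent of
    M + y_t I in this way.  This is a monic polynomial of degree n in y_t, so n values at points
    with invertible differences determine its constant coefficient per M.  At most n(n+1)/2
    points make a leading minor of M + x I vanish in the field, so all points are good and
    distinct except with probability 2 n^3 / 2^d.

    The algorithm uses O(n^4) ring operations and no fast matrix multiplication; as a product of
    n x n matrices has n^2 distinct outputs, omega >= 2, and this is within n^(2 + omega). *)

Require Import Defs.
From HB Require Import structures.
From mathcomp Require Import all_boot all_order all_fingroup all_algebra all_field.
From mathcomp Require Import all_classical all_reals all_analysis.
From mathcomp Require Import ring lra zify.
Set Implicit Arguments.
Unset Strict Implicit.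
Unset Printing Implicit Defensive.
Import Order.TTheory GRing.Theory Num.Theory.
Local Open Scope ring_scope.

(** * The permanent modulo 4 from an LU factorisation *)

(** The squares are forced by the factor 2: when 4 = 0, the map sending x to 2x^2 is additive, so a
    doubled correction coming from a row operation can be absorbed into a sum of squares. The
    inverse P enters through Jacobi's identity: a permanent with two equal rows is twice a sum of
    determinants with two rows replaced, and each of these is det A times a 2 x 2 minor of P.

    The obstacle is that M may be singular modulo 2, so that no pivots exist. The shift by x I
    removes it for every M at once: modulo 2, each leading minor is a monic polynomial in x, hence
    never identically zero. The ring has zero divisors, so interpolation needs differences of nodes
    that are units, that is, nodes that stay distinct modulo 2; lifts of distinct field elements
    have this property.

    The machine program is fixed syntax. Its time is bounded by compiling it from a small array
    language whose loops are governed by n alone: the exponent of n is then the nesting depth of the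
    source. Division is total, so a bad tape halts within the same time as a good one. *)

Section PermanentModFour.
Variable R : comNzRingType.
Hypothesis four0 : 4%:R = 0 :> R.

Definition repl n (A : 'M[R]_n) (j : 'I_n) (v : 'I_n -> R) (i : 'I_n) (w : 'I_n -> R) : 'M[R]_n :=
  \matrix_(k, l) if k == i then w l else if k == j then v l else A k l.

(** Only the identity and the transposition of [i] and [j] contribute: any other permutation moves a
    third index and meets a zero of the identity matrix there. *)
Lemma det_repl1 n (i j : 'I_n) (x y : 'I_n -> R) : i != j ->
  \det (repl 1%:M j x i y) = x j * y i - x i * y j.
Proof.
move=> nij; rewrite /determinant (bigD1 1%g) //= (bigD1 (tperm i j)) /=; last first.
  by apply/eqP => /(congr1 (fun s : 'S_n => s i)); rewrite tpermL perm1 => /eqP; rewrite eq_sym (negPf nij).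
rewrite [X in _ + (_ + X)]big1 ?addr0 => [|s /andP[s1 s2]]; last first.
  have [k /andP[/andP[ki kj] ks]] : exists k, (k != i) && (k != j) && (s k != k).
    apply/existsP; apply: contraNT s2; rewrite negb_exists => /forallP sk.
    have fixk k : k != i -> k != j -> s k = k.
      by move=> ki kj; have := sk k; rewrite ki kj /= negbK => /eqP.
    apply/eqP/permP => k; case: tpermP => [->|->|/eqP ki /eqP kj]; last exact: fixk.
    - case: (eqVneq (s i) j) => // sij; case/eqP: s1; apply/permP => l; rewrite perm1.
      have sii : s i = i.
        case: (eqVneq (s i) i) => // sii.
        by have := fixk _ sii sij => /perm_inj sE; rewrite sE eqxx in sii.
      case: (eqVneq l i) => [->//|li]; case: (eqVneq l j) => [->|lj]; last exact: fixk.
      case: (eqVneq (s j) j) => // sjj.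
      have sji : s j != i by apply: contraNneq nij => sji; rewrite -(inj_eq (@perm_inj _ s)) sii sji.
      by have := fixk _ sji sjj => /perm_inj sE; rewrite sE eqxx in sjj.
    - case: (eqVneq (s j) i) => // sji; case/eqP: s1; apply/permP => l; rewrite perm1.
      have sjj : s j = j.
        case: (eqVneq (s j) j) => // sjj.
        by have := fixk _ sji sjj => /perm_inj sE; rewrite sE eqxx in sjj.
      case: (eqVneq l j) => [->//|lj]; case: (eqVneq l i) => [->|li]; last exact: fixk.
      case: (eqVneq (s i) i) => // sii.
      have sij : s i != j by apply: contraNneq nij => sij; rewrite -(inj_eq (@perm_inj _ s)) sij sjj.
      by have := fixk _ sii sij => /perm_inj sE; rewrite sE eqxx in sii.
  rewrite (bigD1 k) //= !mxE (negPf ki) (negPf kj) eq_sym (negPf ks) mul0r mulr0 //.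
rewrite odd_perm1 expr0 mul1r odd_tperm nij expr1 mulN1r.
rewrite (bigD1 i) //= (bigD1 j) ?(eq_sym j) //= !perm1 !mxE !eqxx (eq_sym j) (negPf nij).
rewrite big1 ?mulr1 => [|k /andP[ki kj]]; last first.
  by rewrite !mxE (negPf ki) (negPf kj) perm1 eqxx.
rewrite (bigD1 i) //= (bigD1 j) ?(eq_sym j) //= !mxE tpermL tpermR !eqxx (eq_sym j) (negPf nij).
rewrite big1 ?mulr1 => [|k /andP[ki kj]]; last first.
  by rewrite !mxE (negPf ki) (negPf kj) tpermD ?(eq_sym _ k) // eqxx.
by rewrite mulrC [y j * _]mulrC.
Qed.

Definition unitv n (k l : 'I_n) : R := (l == k)%:R.

(** Jacobi's identity for two rows. Row [k] of [P] times [A] is the [k]-th unit vector, so the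
    replaced matrix is [A] multiplied on the left by an identity with two rows taken from [P]. *)
Lemma det_repl_unit n (A P : 'M[R]_n) (i j k l : 'I_n) : i != j -> A *m P = 1%:M ->
  \det (repl A j (unitv k) i (unitv l)) = \det A * (P k j * P l i - P k i * P l j).
Proof.
move=> nij AP; have PA : P *m A = 1%:M by apply: mulmx1C.
have -> : repl A j (unitv k) i (unitv l) = repl 1%:M j (P k) i (P l) *m A.
  have rowP r c : \sum_m P r m * A m c = (c == r)%:R.
    by have /matrixP/(_ r c) := PA; rewrite !mxE eq_sym.
  apply/matrixP => r c; rewrite !mxE; case: (eqVneq r i) => [ri|ri].
    by under eq_bigr do rewrite mxE ri eqxx; rewrite rowP.
  case: (eqVneq r j) => [rj|rj].
    by under eq_bigr do rewrite mxE rj eq_sym (negPf nij) eqxx; rewrite rowP.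
  under eq_bigr do rewrite !mxE (negPf ri) (negPf rj).
  by rewrite -[A in LHS]mul1mx mxE; apply: eq_bigr => m _; rewrite mxE.
by rewrite det_mulmx det_repl1 // mulrC.
Qed.

(** Signs disappear because 2 = -2. *)
Lemma two_permanent_det n (A : 'M[R]_n) : 2%:R * permanent A = 2%:R * \det A.
Proof.
rewrite /permanent /determinant !mulr_sumr; apply: eq_bigr => s _.
case: (odd_perm s); rewrite ?expr0 ?mul1r // expr1 mulN1r.
by apply/eqP; rewrite -subr_eq0 mulrN opprK -mulrDl -natrD four0 mul0r.
Qed.

Lemma two_opp (x : R) : - (2%:R * x) = 2%:R * x.
Proof. by apply/eqP; rewrite eq_sym -subr_eq0 opprK -mulrDl -natrD four0 mul0r. Qed.

Lemma permanent_repl2 n (A : 'M[R]_n) (i j : 'I_n) (v w : 'I_n -> R) : i != j ->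
  permanent (repl A j v i w) =
  \sum_k \sum_l v k * w l * permanent (repl A j (unitv k) i (unitv l)).
Proof.
move=> nij; have nji : j != i by rewrite eq_sym.
have expand x y : permanent (repl A j x i y) =
    \sum_(s : 'S_n) x (s j) * y (s i) * \prod_(m | (m != i) && (m != j)) A m (s m).
  apply: eq_bigr => s _; rewrite (bigD1 i) //= (bigD1 j) //= !mxE !eqxx (negPf nji) mulrA [_ * x _]mulrC.
  by congr (_ * _); apply: eq_bigr => m /andP[mi mj]; rewrite mxE (negPf mi) (negPf mj).
under [RHS]eq_bigr => k _.
  under eq_bigr => l _ do rewrite expand mulr_sumr.
  rewrite exchange_big /=; over.
rewrite exchange_big expand; apply: eq_bigr => s _.
rewrite [RHS](bigD1 (s j)) //= [X in _ = X + _](bigD1 (s i)) //= /unitv !eqxx !mul1r.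
rewrite [X in _ = _ + X + _]big1 => [|l nl]; last by rewrite eq_sym (negPf nl) mulr0 mul0r mulr0.
rewrite [X in _ = _ + X]big1 ?addr0 // => k nk; rewrite big1 // => l _.
by rewrite eq_sym (negPf nk) !mul0r mulr0.
Qed.

(** This symmetry makes the off-diagonal terms of the bilinear expansion come in equal pairs. The
    factor 2 so produced is what allows permanents to be traded for determinants. *)
Lemma permanent_repl_swap n (A : 'M[R]_n) (i j : 'I_n) (v w : 'I_n -> R) : i != j ->
  permanent (repl A j v i w) = permanent (repl A j w i v).
Proof.
move=> nij; rewrite /permanent (reindex_inj (mulgI (tperm i j))) /=; apply: eq_bigr => s _.
rewrite (reindex_inj (@perm_inj _ (tperm i j))) /=; apply: eq_bigr => m _.
rewrite !mxE permM tpermK; case: tpermP => [->|->|/eqP mi /eqP mj].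
- by rewrite (eq_sym j) (negPf nij) !eqxx.
- by rewrite (eq_sym j) (negPf nij) !eqxx.
- by rewrite (negPf mi) (negPf mj).
Qed.

Lemma sum_sym_pairs n (f : 'I_n -> 'I_n -> R) : (forall k l, f k l = f l k) ->
  \sum_k \sum_l f k l = 2%:R * (\sum_(k : 'I_n) \sum_(l : 'I_n | (k < l)%N) f k l) + \sum_k f k k.
Proof.
move=> fC; have -> : \sum_k \sum_l f k l =
   \sum_(k : 'I_n) \sum_(l : 'I_n | (k < l)%N) f k l + \sum_(k : 'I_n) \sum_(l : 'I_n | (l < k)%N) f k l + \sum_k f k k.
  rewrite -!big_split; apply: eq_bigr => k _ /=.
  rewrite (bigID (fun l : 'I_n => (k < l)%N)) /= -addrA; congr (_ + _).
  rewrite (bigD1 k) ?ltnn //= addrC; congr (_ + _); apply: eq_bigl => l.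
  by rewrite -leqNgt ltn_neqAle andbC.
congr (_ + _); rewrite mulrDl mul1r; congr (_ + _).
rewrite (exchange_big_dep xpredT) //=.
by apply: eq_bigr => k _; apply: eq_bigr => l _; exact: fC.
Qed.

(* With rows i and j both equal to v, the permanent is a quadratic form in v whose polar form
   is, modulo 2, the determinant with rows j and i replaced; (A P = 1) evaluates the latter. *)
Lemma permanent_repl_same n (A P : 'M[R]_n) (i j : 'I_n) : i != j -> A *m P = 1%:M ->
  permanent (repl A j (A j) i (A j)) = 2%:R * (\det A * \sum_k A j k ^+ 2 * (P k j * P k i)).
Proof.
move=> nij AP; rewrite permanent_repl2 // sum_sym_pairs; last first.
  by move=> k l; rewrite permanent_repl_swap // [A j k * _]mulrC.
(* Diagonal terms vanish: rows [i] and [j] are then the same unit vector, and a nonzero product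
   would send both indices to one column. *)
rewrite [X in _ + X]big1 ?addr0 => [|k _]; last first.
  rewrite /permanent big1 ?mulr0 // => s _; rewrite (bigD1 i) //= (bigD1 j) ?(eq_sym j) //= !mxE !eqxx.
  rewrite (eq_sym j) (negPf nij) /unitv mulrA -natrM mulnb.
  case: eqP => [e1|]; last by rewrite mul0r.
  by case: eqP => [e2|]; rewrite ?mul0r //; case/eqP: nij; apply: (@perm_inj _ s); rewrite e1.
transitivity (2%:R * \sum_(k : 'I_n) \sum_(l : 'I_n | (k < l)%N) A j k * A j l * (\det A * (P k j * P l i + P k i * P l j))).
  rewrite !mulr_sumr; apply: eq_bigr => k _; rewrite !mulr_sumr; apply: eq_bigr => l _.
  rewrite mulrCA two_permanent_det (det_repl_unit _ _ nij AP).
  rewrite [RHS]mulrCA; congr (_ * _); rewrite !(mulrA 2%:R) !(mulrDr, mulrN).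
  congr (_ + _); rewrite -mulrA; exact: two_opp.
(* The unrestricted double sum factors through the entry [(j, i)] of [A *m P], which is 0. Hence the
   doubled off-diagonal part is minus the doubled diagonal part, and the sign is immaterial since 2
   = -2. *)
have E : \sum_k \sum_l A j k * A j l * (P k j * P l i) = 0.
  transitivity ((\sum_k A j k * P k j) * \sum_l A j l * P l i).
    rewrite mulr_suml; apply: eq_bigr => k _; rewrite mulr_sumr; apply: eq_bigr => l _.
    by rewrite mulrACA.
  have /matrixP/(_ j i) := AP; rewrite !mxE (eq_sym j) (negPf nij) => ->.
  by rewrite mulr0.
have : 2%:R * \sum_(k : 'I_n) \sum_(l : 'I_n | (k < l)%N) A j k * A j l * (P k j * P l i + P k i * P l j)
   + 2%:R * \sum_k A j k ^+ 2 * (P k j * P k i) = 0 :> R.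
  rewrite [X in _ + X]mulr_sumr.
  transitivity (\sum_k \sum_l A j k * A j l * (P k j * P l i + P k i * P l j)).
    rewrite sum_sym_pairs; last by move=> k l; ring.
    by congr (_ + _); apply: eq_bigr => k _; ring.
  transitivity (\sum_k \sum_l A j k * A j l * (P k j * P l i) +
                \sum_k \sum_l A j l * A j k * (P l j * P k i)).
    rewrite -big_split; apply: eq_bigr => k _; rewrite -big_split; apply: eq_bigr => l _ /=.
    by ring.
  by rewrite [X in _ + X]exchange_big E addr0.
move=> /eqP; rewrite addr_eq0 two_opp => /eqP H.
rewrite mulrCA -H mulrCA; congr (_ * _); rewrite mulr_sumr; apply: eq_bigr => k _.
by rewrite mulr_sumr; apply: eq_bigr => l _; rewrite mulrCA.
Qed.

(** Linearity in row [i]: the increment is [c] times the permanent with row [i] overwritten by row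
    [j]. *)
Lemma permanent_rowop n (A P : 'M[R]_n) (i j : 'I_n) (c : R) : i != j -> A *m P = 1%:M ->
  permanent (\matrix_(k, l) (A k l + (k == i)%:R * c * A j l)) =
  permanent A + 2%:R * (c * \det A * \sum_k A j k ^+ 2 * (P k j * P k i)).
Proof.
move=> nij AP.
rewrite -mulrA [RHS](_ : _ = permanent A + c * permanent (repl A j (A j) i (A j))); last first.
  by rewrite (permanent_repl_same nij AP); ring.
rewrite /permanent mulr_sumr -big_split; apply: eq_bigr => s _ /=.
rewrite (bigD1 i) //= [in RHS](bigD1 i) //= [X in _ = _ + c * X](bigD1 i) //= !mxE !eqxx mul1r.
rewrite mulrDl mulrA; congr (_ * _ + _ * _); apply: eq_bigr => k ki; rewrite !mxE (negPf ki).
  by rewrite ?mul0r ?addr0.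
by rewrite !mul0r addr0; case: eqP => [->|].
Qed.

(** Without the squares this is the trace of [L *m U *m P]. *)
Definition Psi n (L U P : 'M[R]_n) : R := \sum_i \sum_j \sum_k (L i j * U j k * P k i) ^+ 2.

Lemma two_sum_sqr n (f : 'I_n -> R) : 2%:R * (\sum_k f k ^+ 2) = 2%:R * (\sum_k f k) ^+ 2.
Proof.
have -> : (\sum_k f k) ^+ 2 = \sum_k \sum_l f k * f l.
  by rewrite expr2 mulr_suml; apply: eq_bigr => k _; rewrite mulr_sumr.
rewrite sum_sym_pairs => [|k l]; last exact: mulrC.
by rewrite mulrDr mulrA -natrM four0 mul0r add0r.
Qed.

(** Row [j] of [L] is a unit vector, so the new entry adds [c] times row [j] of [U] to row [i] of
    the product, and in the inverse it subtracts [c] times column [i] from column [j]. In [Psi] only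
    the outer indices [i] and [j] are affected: the first gains the squares of [c * U j k * P k i],
    in the second [P k j] becomes [P k j - c * P k i]. The change matches that of
    [permanent_rowop]. *)
Lemma permanent_LU_step n (L U P : 'M[R]_n) (i j : 'I_n) (c : R) : i != j ->
  L *m U *m P = 1%:M -> (forall k, L j k = (k == j)%:R) -> L i j = 0 ->
  permanent (L *m U) = \det (L *m U) * (1 + n%:R - Psi L U P) ->
  let L' := L + c *: delta_mx i j in
  exists2 P', L' *m U *m P' = 1%:M &
    permanent (L' *m U) = \det (L' *m U) * (1 + n%:R - Psi L' U P').
Proof.
move=> nij LUP Lj Lij IH L'; have nji : j != i by rewrite eq_sym.
have AjE k : (L *m U) j k = U j k.
  by rewrite mxE (bigD1 j) //= Lj eqxx mul1r big1 ?addr0 // => m mj; rewrite Lj (negPf mj) mul0r.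
have L'E : L' *m U = (1%:M + c *: delta_mx i j) *m (L *m U).
  rewrite mulmxA mulmxDl mul1mx -scalemxAl; congr ((L + c *: _) *m U).
  apply/matrixP => r s; rewrite !mxE (bigD1 j) //= !mxE eqxx andbT Lj big1 ?addr0 => [|m mj].
    by rewrite -natrM mulnb.
  by rewrite !mxE (negPf mj) andbF mul0r.
have detE : \det (L' *m U) = \det (L *m U).
  rewrite L'E det_mulmx (_ : 1%:M + _ = repl 1%:M j (unitv j) i (fun l => unitv i l + c * unitv j l)).
    by rewrite det_repl1 // /unitv !eqxx (negPf nij) mulr0 addr0 mul0r subr0 !mul1r.
  apply/matrixP => r s; rewrite !mxE /unitv; case: (eqVneq r i) => [->|ri] /=; first by rewrite eq_sym.
  by rewrite mulr0 addr0; case: (eqVneq r j) => [->|//]; rewrite eq_sym.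
have rowE : L' *m U = \matrix_(k, l) ((L *m U) k l + (k == i)%:R * c * (L *m U) j l).
  rewrite L'E mulmxDl mul1mx; apply/matrixP => r s; rewrite [in LHS]mxE [in RHS]mxE; congr (_ + _).
  rewrite mxE (bigD1 j) //= big1 ?addr0 => [|m mj]; last by rewrite !mxE (negPf mj) andbF mulr0 mul0r.
  by rewrite !mxE eqxx andbT [c * _]mulrC.
exists (P *m (1%:M - c *: delta_mx i j)).
  rewrite L'E mulmxA -(mulmxA _ (L *m U)) LUP mulmx1 mulmxDl mul1mx mulmxBr mulmx1.
  rewrite -scalemxAl -scalemxAr mul_delta_mx_cond (negPf nji) mulr0n !scaler0 subr0.
  by rewrite subrK.
rewrite detE rowE (permanent_rowop _ nij LUP) IH.
under eq_bigr do rewrite AjE.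
set P' := P *m _.
have P'E k r : P' k r = P k r - (r == j)%:R * c * P k i.
  rewrite /P' mulmxBr mulmx1 mxE; congr (_ + _); rewrite mxE mxE (bigD1 i) //= big1 ?addr0 => [|m mi].
    by rewrite !mxE eqxx /=; ring.
  by rewrite !mxE (negPf mi) mulr0 mulr0.
(* This kills the part of the change that is quadratic in [c]: twice the sum of squares is twice the
   square of an off-diagonal entry of [L *m U *m P]. *)
have zero2 : 2%:R * \sum_k (U j k * P k i) ^+ 2 = 0.
  have /matrixP/(_ j i) := LUP; rewrite mxE [in X in _ = X]mxE (negPf nji) => E.
  by rewrite two_sum_sqr; under eq_bigr do rewrite -AjE; rewrite E expr0n mulr0.
have -> : Psi L' U P' = Psi L U P - 2%:R * (c * \sum_k U j k ^+ 2 * (P k j * P k i)).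
  have Pi : \sum_s \sum_k (L' i s * U s k * P' k i) ^+ 2 =
      \sum_s \sum_k (L i s * U s k * P k i) ^+ 2 + \sum_k (c * U j k * P k i) ^+ 2.
    rewrite (bigD1 j) //= [in RHS](bigD1 j) //= [X in _ = X + _ + _]big1 => [|k _]; last first.
      by rewrite Lij !mul0r expr0n.
    rewrite add0r addrC; congr (_ + _).
      apply: eq_bigr => s sj; apply: eq_bigr => k _.
      by rewrite P'E !mxE (negPf nij) (negPf sj) andbF mulr0 addr0 !mul0r subr0.
    apply: eq_bigr => k _.
    by rewrite P'E !mxE (negPf nij) !eqxx Lij mulr1 add0r !mul0r subr0.
  have Pj : \sum_s \sum_k (L' j s * U s k * P' k j) ^+ 2 =
      \sum_s \sum_k (L j s * U s k * P k j) ^+ 2 +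
      \sum_k ((U j k * (P k j - c * P k i)) ^+ 2 - (U j k * P k j) ^+ 2).
    have z s : s != j -> \sum_k (L j s * U s k * P k j) ^+ 2 = 0.
      by move=> sj; rewrite big1 // => k _; rewrite Lj (negPf sj) !mul0r expr0n.
    rewrite [LHS](bigD1 j) //= [X in _ = X + _](bigD1 j) //= [X in _ = _ + X + _]big1 // addr0.
    rewrite [X in _ + X = _]big1 ?addr0 => [|s sj]; last first.
      by rewrite big1 // => k _; rewrite !mxE Lj (negPf sj) (negPf nji) mulr0 addr0 !mul0r expr0n.
    rewrite -big_split; apply: eq_bigr => k _ /=; rewrite P'E !mxE Lj !eqxx (negPf nji) mulr0 addr0 !mul1r.
    by ring.
  rewrite /Psi [LHS](bigD1 i) //= [X in _ + X = _](bigD1 j) //=.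
  rewrite [X in _ = X - _](bigD1 i) //= [X in _ = _ + X - _](bigD1 j) //=.
  rewrite Pi Pj [X in _ + _ + (_ + X)](eq_bigr (fun r => \sum_s \sum_k (L r s * U s k * P k r) ^+ 2)); last first.
    move=> r /andP[ri rj]; apply: eq_bigr => s _; apply: eq_bigr => k _.
    by rewrite P'E !mxE (negPf ri) (negPf rj) mulr0 addr0 !mul0r subr0.
  have E : \sum_k (c * U j k * P k i) ^+ 2 +
     \sum_k ((U j k * (P k j - c * P k i)) ^+ 2 - (U j k * P k j) ^+ 2) =
     - (2%:R * (c * \sum_k U j k ^+ 2 * (P k j * P k i))).
    transitivity (c ^+ 2 * (2%:R * \sum_k (U j k * P k i) ^+ 2) -
                  (2%:R * (c * \sum_k U j k ^+ 2 * (P k j * P k i)))).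
      by rewrite -big_split !mulr_sumr -sumrB; apply: eq_bigr => k _ /=; ring.
    by rewrite zero2 mulr0 add0r.
  rewrite -E; ring.
by ring.
Qed.

(** The diagonal entries of [U] are units because their product is the invertible [\det U]. The
    entries of [Q] below the diagonal are then cleared from the last row upwards. *)
Lemma upper_inverse n (U Q : 'M[R]_n) :
  (forall j k : 'I_n, (k < j)%N -> U j k = 0) -> U *m Q = 1%:M ->
  forall j k : 'I_n, (k < j)%N -> Q j k = 0.
Proof.
move=> Uup UQ.
have Uunit j : exists x, x * U j j = 1.
  have : \det U * \det Q = 1 by rewrite -det_mulmx UQ det1.
  rewrite -det_tr det_trig => [|]; last by apply/is_trig_mxP => r s rs; rewrite mxE Uup.
  rewrite (bigD1 j) //= mxE => E; exists (\prod_(i | i != j) U^T i i * \det Q).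
  by rewrite mulrC mulrA.
move=> j k; move: {2}(n - j)%N (leqnn (n - j)%N) => m; elim: m j => [|m IH] j.
  by rewrite leqn0 subn_eq0 leqNgt ltn_ord.
move=> jm kj; have [x xU] := Uunit j; have /matrixP/(_ j k) := UQ; rewrite !mxE.
rewrite (bigD1 j) //= big1 ?addr0 => [|i ij].
  have -> : (j == k) = false by apply/eqP => jk; rewrite jk ltnn in kj.
  by move/(congr1 ( *%R x)); rewrite mulrA xU mul1r mulr0.
case: (ltngtP i j) => [ij'|ji|/val_inj/eqP]; last by rewrite (negPf ij).
  by rewrite Uup ?mul0r.
rewrite IH ?mulr0 ?(ltn_trans kj) //.
by rewrite -ltnS (leq_trans _ jm) // ltn_sub2l.
Qed.

(** A permutation with [s i >= i] for all [i] is the identity, by descending induction on [i]; every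
    other one picks an entry below the diagonal. *)
Lemma permanent_upper n (U : 'M[R]_n) :
  (forall j k : 'I_n, (k < j)%N -> U j k = 0) -> permanent U = \det U.
Proof.
move=> Uup; rewrite /permanent /determinant; apply: eq_bigr => s _.
case: (eqVneq s 1%g) => [->|s1]; first by rewrite odd_perm1 expr0 mul1r.
have [i si] : exists i, (s i < i)%N.
  apply/existsP; apply: contraNT s1; rewrite negb_exists => /forallP H.
  apply/eqP/permP => i; rewrite perm1; move: {2}(n - i)%N (leqnn (n - i)%N) => m.
  elim: m i => [|m IH] i; first by rewrite leqn0 subn_eq0 leqNgt ltn_ord.
  move=> im; have := H i; rewrite -leqNgt leq_eqVlt => /orP[/eqP/val_inj//|isi].
  have /perm_inj sE : s (s i) = s i by apply: IH; have := ltn_ord (s i); lia.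
  by rewrite sE ltnn in isi.
by rewrite (bigD1 i) //= Uup // !mul0r mulr0.
Qed.

Theorem permanent_LU n (L U P : 'M[R]_n) :
  (forall i, L i i = 1) -> (forall i j : 'I_n, (i < j)%N -> L i j = 0) ->
  (forall j k : 'I_n, (k < j)%N -> U j k = 0) -> L *m U *m P = 1%:M ->
  permanent (L *m U) = \det (L *m U) * (1 + n%:R - Psi L U P).
Proof.
move=> Ldiag Llow Uup LUP.
have UPL : U *m (P *m L) = 1%:M by rewrite mulmxA; apply: mulmx1C; rewrite mulmxA.
pose Lm m : 'M[R]_n := \matrix_(i, j) if i == j then 1 else if (m <= i * n + j)%N then L i j else 0.
(* L is built from 1 one entry at a time, last rows first: when the entry (i, j) is added,
   row j < i is still a unit vector, so this is a row operation with row j of U. *)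
have step m : (m <= n * n)%N -> exists2 Q, Lm m *m U *m Q = 1%:M &
    permanent (Lm m *m U) = \det (Lm m *m U) * (1 + n%:R - Psi (Lm m) U Q).
  move=> mn; rewrite -(subKn mn); elim: (n * n - m)%N => [|r IH].
    (* Base case: the left factor is 1, the permanent of [U] is its determinant, and [Psi] is [n]
       because corresponding diagonal entries of [U] and of its inverse multiply to 1. *)
    have -> : Lm (n * n - 0)%N = 1%:M.
      apply/matrixP => i j; rewrite !mxE subn0; case: eqP => // _; rewrite leqNgt ifN // negbK.
      by rewrite (@leq_trans (i * n + n)) ?ltn_add2l // -mulSnr leq_mul2r ltn_ord orbT.
    exists (P *m L); rewrite ?mul1mx // permanent_upper // (_ : Psi _ _ _ = n%:R) ?addrK ?mulr1 //.
    rewrite /Psi -[in RHS](card_ord n) -sumr_const; apply: eq_bigr => i _.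
    rewrite (bigD1 i) //= [X in _ + X]big1 ?addr0 => [|j ij]; last first.
      by rewrite big1 // => k _; rewrite mxE eq_sym (negPf ij) !mul0r expr0n.
    have UQ0 k : k != i -> U i k * (P *m L) k i = 0.
      rewrite neq_ltn => /orP[ki|ik]; first by rewrite Uup ?mul0r.
      by rewrite (upper_inverse Uup UPL ik) mulr0.
    have /matrixP/(_ i i) := UPL; rewrite mxE mxE eqxx (bigD1 i) //= big1 ?addr0 // => UPi.
    rewrite (bigD1 i) //= mul1r UPi expr1n big1 ?addr0 // => k ki.
    by rewrite mul1r UQ0 ?expr0n.

  case: (ltnP r (n * n)) => rn; last first.
    by rewrite (_ : n * n - r.+1 = n * n - r)%N //; lia.
  set q := (n * n - r.+1)%N; have qE : (n * n - r = q.+1)%N by rewrite /q subnSK.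
  have qn : (q < n * n)%N by rewrite /q; lia.
  rewrite qE in IH; have n0 : (0 < n)%N by case: (n) qn.
  have iP : (q %/ n < n)%N by rewrite ltn_divLR.
  have jP : (q %% n < n)%N by rewrite ltn_pmod.
  pose i := Ordinal iP; pose j := Ordinal jP.
  have ijE : (i * n + j = q)%N by rewrite /= -divn_eq.
  have ijU (i' j' : 'I_n) : (i' * n + j' = q)%N -> (i' = i) /\ (j' = j).
    move=> e; split; apply: val_inj; rewrite /= -e.
      by rewrite divnMDl // divn_small ?addn0.
    by rewrite modnMDl modn_small.
  (* Positions on or above the diagonal change nothing. *)
  case: (ltnP j i) => ji; last first.
    have -> // : Lm q = Lm q.+1.
      apply/matrixP => i' j'; rewrite !mxE; case: eqP => // ij'; rewrite leq_eqVlt.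
      case: eqP => // e; have [ei ej] := ijU _ _ (esym e).
      by rewrite ltn_neqAle -e eqxx /= Llow // ei ej ltn_neqAle ji andbT; apply/eqP => /val_inj ?; apply: ij'; rewrite ei ej.
  have nij : i != j by apply/eqP => e; rewrite e ltnn in ji.
  have cmp (i' j' : 'I_n) : (i' != i) || (j' != j) -> (q <= i' * n + j')%N = (q < i' * n + j')%N.
    move=> nn; rewrite (leq_eqVlt q); case: (q =P _) => // e.
    by have [ei ej] := ijU _ _ (esym e); rewrite ei ej !eqxx in nn.
  have -> : Lm q = Lm q.+1 + L i j *: delta_mx i j.
    apply/matrixP => i' j'; rewrite !mxE.
    case: (eqVneq i' i) => [->|ni]; case: (eqVneq j' j) => [->|nj] /=; rewrite ?mulr1 ?mulr0 ?addr0.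
    - by rewrite (negPf nij) ijE leqnn ltnn add0r.
    - by have /= -> := cmp i j'; rewrite ?nj ?orbT.
    - by have /= -> := cmp i' j; rewrite ?ni.
    - by rewrite cmp ?ni.
  have [Q LQ IHQ] := IH; have nij' := nij; apply: permanent_LU_step nij' LQ _ _ IHQ.
  - move=> k; rewrite mxE (eq_sym k); case: eqP => // jk.
    case: leqP => // le; move: le; rewrite -ijE ltnNge => /negP[]; apply: ltnW.
    apply: (@leq_trans (j.+1 * n)); first by rewrite mulSnr ltn_add2l.
    by rewrite (leq_trans _ (leq_addr _ _)) // leq_mul2r ji orbT.
  - by rewrite mxE (negPf nij) ijE ltnn.
have [Q LQ H] := step 0%N isT.
have L0 : Lm 0%N = L.
  apply/matrixP => i j; rewrite mxE; case: eqP => [->|//]; by rewrite Ldiag.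
(* The construction yields some inverse [Q]; by uniqueness it is [P]. *)
rewrite L0 in LQ H; rewrite H (_ : Q = P) //.
by rewrite -[Q]mul1mx -(mulmx1C LUP) -mulmxA LQ mulmx1.
Qed.
End PermanentModFour.

(** * Gauss-Jordan sweeps without pivoting *)

Section Sweep.
Variables (R : comNzRingType) (einv : R -> R).
Implicit Types A B : nat -> nat -> R.

(** The principal pivot transform: the [p]-th equation of y = A x is solved for [x p] and
    substituted into the others. [einv] is an arbitrary function here; [good_pivot] states when it
    really inverts. The form [0 - _] matches the expression compiled later. *)
Definition sweep A p i j : R :=
  if i == p then if j == p then einv (A p p) else 0 - A p j * einv (A p p)
  else if j == p then A i p * einv (A p p) else A i j - A i p * einv (A p p) * A p j.

Fixpoint sweeps A p : nat -> nat -> R :=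
  if p is q.+1 then sweep (sweeps A q) q else A.

(** Row [i] of U is read off just before sweep [i], as is column [j] of L before sweep [j], so both
    can be saved while the matrix is swept in place. *)
Definition sweepU A i j : R := if (j < i)%N then 0 else sweeps A i i j.
Definition sweepL A i j : R :=
  if (i < j)%N then 0 else sweeps A j i j * einv (sweeps A j j j).
Definition good_pivot A p := sweeps A p p p * einv (sweeps A p p p) = 1.
Definition block n A : 'M[R]_n := \matrix_(i, j) A i j.

(** On the trailing block, sweep [q] subtracts the rank-one matrix formed by column [q] of L and row
    [q] of U. *)
Lemma sweeps_schur A i j p : (p <= i)%N -> (p <= j)%N ->
  A i j = \sum_(q < p) sweepL A i q * sweepU A q j + sweeps A p i j.
Proof.
elim: p => [|p IH] ip jp; first by rewrite big_ord0 add0r.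
rewrite big_ord_recr /= (IH (ltnW ip) (ltnW jp)) -addrA; congr (_ + _).
rewrite /sweepL /sweepU !ltnNge !(ltnW ip) !(ltnW jp) /= /sweep.
by rewrite !gtn_eqF // addrC subrK.
Qed.

(** The last pivot is deliberately left out of the hypothesis: with the diagonal of L set to 1,
    nothing is divided by it. This lets its invertibility be deduced from the determinant. *)
Lemma block_LU n A : (forall p, (p.+1 < n)%N -> good_pivot A p) ->
  block n A = block n (fun i q => if i == q then 1 else sweepL A i q) *m block n (sweepU A).
Proof.
move=> good; apply/matrixP => i j; rewrite !mxE.
under eq_bigr do rewrite !mxE.
(* The product sum is cut at the smaller index: earlier terms are those of [sweeps_schur], the term
   at the cut supplies the Schur complement, later ones vanish by triangularity. *)
have mn : (minn i j < n)%N by rewrite gtn_min ltn_ord.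
rewrite (sweeps_schur A (geq_minl i j) (geq_minr i j)).
pose F q := (if i == q :> nat then 1 else sweepL A i q) * sweepU A q j.
rewrite -(big_mkord xpredT F) (big_cat_nat (n := minn i j)) ?(ltnW mn) //=.
rewrite [X in _ = _ + X]big_ltn //=.
have -> : \sum_(q < minn i j) sweepL A i q * sweepU A q j = \sum_(0 <= q < minn i j) F q.
  rewrite big_mkord; apply: eq_bigr => q _; rewrite /F gtn_eqF //.
  by apply: leq_trans (ltn_ord q) (geq_minl _ _).
congr (_ + _); rewrite big_nat big1 ?addr0 => [|q /andP[mq _]]; last first.
  rewrite /F /sweepU /sweepL; move: mq; rewrite gtn_min => /orP[iq|->]; last by rewrite mulr0.
  by rewrite ltn_eqF // iq mul0r.
rewrite /F /sweepL /sweepU; case: (ltngtP i j) => ij.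
- by rewrite eqxx mul1r ltnNge (ltnW ij).
- rewrite gtn_eqF // ltnn ltnNge (ltnW ij) /= -mulrA [einv _ * _]mulrC.
  by rewrite good ?mulr1 // (leq_trans _ (ltn_ord i)).
- by rewrite ij eqxx ltnn mul1r.
Qed.

Lemma det_block n A : (forall p, (p.+1 < n)%N -> good_pivot A p) ->
  \det (block n A) = \prod_(p < n) sweepU A p p.
Proof.
move=> good; rewrite (block_LU good) det_mulmx.
rewrite det_trig => [|]; last first.
  by apply/is_trig_mxP => i j ij; rewrite mxE ltn_eqF // /sweepL ij.
rewrite big1 => [|i _]; last by rewrite mxE eqxx.
rewrite mul1r -det_tr det_trig => [|]; last first.
  by apply/is_trig_mxP => i j ij; rewrite !mxE /sweepU ij.
by apply: eq_bigr => i _; rewrite !mxE.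
Qed.

(* With y = A x, p sweeps exchange the roles of the first p coordinates of x and y. *)
Lemma sweeps_exchange n A p (x : nat -> R) : (p <= n)%N ->
  (forall q, (q < p)%N -> good_pivot A q) ->
  let y i := \sum_(j < n) A i j * x j in
  forall i, (i < n)%N -> (if (i < p)%N then x i else y i) =
    \sum_(j < n) sweeps A p i j * (if (j < p)%N then y j else x j).
Proof.
move=> pn good y; elim: p pn good => [//|p IH] pn good i ilt /=.
pose B := sweeps A p; pose z := fun j => if (j < p)%N then y j else x j.
have {}IH k : (k < n)%N -> (if (k < p)%N then x k else y k) = \sum_(j < n) B k j * z j.
  exact: (IH (ltnW pn) (fun q qp => good q (leqW qp))).
rewrite -/B.
have gp : B p p * einv (B p p) = 1 by apply: good.
have zE (f : nat -> R) : \sum_(j < n | j != p :> nat) f j * (if (j < p.+1)%N then y j else x j) =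
    \sum_(j < n | j != p :> nat) f j * z j.
  by apply: eq_bigr => j jp; rewrite /z ltnS leq_eqVlt (negPf jp).
have split (f g : nat -> R) : \sum_(j < n) f j * g j = f p * g p + \sum_(j < n | j != p :> nat) f j * g j.
  by rewrite (bigD1 (Ordinal pn)).
have Ep : x p * B p p = y p - \sum_(j < n | j != p :> nat) B p j * z j.
  by have := IH p pn; rewrite ltnn (split (B p) z) {1}/z ltnn => ->; rewrite addrK mulrC.
have xp : x p = einv (B p p) * y p - \sum_(j < n | j != p :> nat) (B p j * einv (B p p)) * z j.
  rewrite -[LHS]mulr1 -gp mulrA Ep mulrBl mulrC; congr (_ - _).
  by rewrite mulr_suml; apply: eq_bigr => j _; rewrite mulrAC.
rewrite (split (sweep B p i) (fun j => if (j < p.+1)%N then y j else x j)) zE ltnSn.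
rewrite /sweep eqxx ltnS leq_eqVlt; case: (eqVneq i p) => [ip|ip] /=.
  rewrite ip xp; congr (_ + _); rewrite -sumrN; apply: eq_bigr => j /negPf jp.
  by rewrite jp sub0r mulNr.
rewrite (IH i ilt) (split (B i) z) {1}/z ltnn xp mulrBr -addrA mulrA; congr (_ + _).
rewrite mulr_sumr -sumrN -big_split; apply: eq_bigr => j /negPf jp /=.
by rewrite jp /z; ring.
Qed.

(** After [n] sweeps the roles of x and y are fully exchanged; unit vectors for x then give the
    columns of the identity. *)
Lemma sweeps_inverse n A : (forall p, (p < n)%N -> good_pivot A p) ->
  block n A *m block n (sweeps A n) = 1%:M.
Proof.
move=> good; apply: mulmx1C; apply/matrixP => i k; rewrite !mxE.
have := sweeps_exchange (fun j => (j == k)%:R) (leqnn n) good (ltn_ord i).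
rewrite ltn_ord -val_eqE => ->; apply: eq_bigr => j _; rewrite !mxE ltn_ord; congr (_ * _).
rewrite (bigD1 k) //= eqxx mulr1 big1 ?addr0 // => l lk.
by rewrite -val_eqE in lk; rewrite (negPf lk) mulr0.
Qed.

(** The summand 1 is moved under the sum over [i], since [n] is not a constant of the array
    language. *)
Lemma permanent_sweep n A : 4%:R = 0 :> R -> (forall p, (p < n)%N -> good_pivot A p) ->
  permanent (block n A) = (\prod_(p < n) sweepU A p p) *
    (1 + \sum_(i < n) (1 - \sum_(j < n) \sum_(k < n)
       (sweepL A i j * sweepU A j k * sweeps A n k i) ^+ 2)).
Proof.
move=> four0 good.
have good' p : (p.+1 < n)%N -> good_pivot A p by move/ltnW/good.
have -> : \prod_(p < n) sweepU A p p = \det (block n A) by rewrite det_block.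
have LE : block n A = block n (sweepL A) *m block n (sweepU A).
  rewrite [LHS]block_LU //; congr (_ *m _); apply/matrixP => i j; rewrite !mxE.
  by case: eqP => // ->; rewrite /sweepL ltnn good.
have := sweeps_inverse good; rewrite LE => inv.
rewrite (permanent_LU four0 _ _ _ inv).
- congr (_ * _); rewrite sumrB sumr_const card_ord -addrA; congr (_ + (_ - _)).
  by apply: eq_bigr => i _; apply: eq_bigr => j _; apply: eq_bigr => k _; rewrite !mxE.
- by move=> i; rewrite mxE /sweepL ltnn good.
- by move=> i j ij; rewrite mxE /sweepL ij.
- by move=> i j ij; rewrite mxE /sweepU ij.
Qed.
End Sweep.

(** * The rings Z_4[x]/(g4) and F_{2^d} *)

Definition red2 (c : 'Z_4) : 'F_2 := (c : nat)%:R.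

Lemma red2_zmod_morphism : zmod_morphism red2.
Proof. by do 2! [case=> [[|[|[|[|//]]]] ?]]; apply: val_inj. Qed.

Lemma red2_monoid_morphism : monoid_morphism red2.
Proof. by split; [apply: val_inj|do 2! [case=> [[|[|[|[|//]]]] ?]]; apply: val_inj]. Qed.

HB.instance Definition _ := GRing.isZmodMorphism.Build 'Z_4 'F_2 red2 red2_zmod_morphism.
HB.instance Definition _ := GRing.isMonoidMorphism.Build 'Z_4 'F_2 red2 red2_monoid_morphism.

Lemma red2_even (c : 'Z_4) : red2 c = 0 -> c = 2%:R * ((c : nat)./2)%:R.
Proof. by case: c => [[|[|[|[|//]]]] ?] => [_|/(congr1 val)|_|/(congr1 val)] //; apply: val_inj. Qed.

Lemma red2_natr (c : 'F_2) : red2 (c : nat)%:R = c.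
Proof. by case: c => [[|[|//]] ?]; apply: val_inj. Qed.

Lemma red_polyE p : red_poly p = map_poly red2 p.
Proof. by []. Qed.

Lemma red_lift_poly p : red_poly (lift_poly p) = p.
Proof.
rewrite /red_poly /lift_poly; apply/polyP => i; rewrite -[LHS]/((map_poly red2 _)`_i).
rewrite coef_map /= coef_map_id0 ?red2_natr //.
Qed.

Lemma size_lift_poly p : size (lift_poly p) = size p.
Proof. by apply: size_map_inj_poly => //; apply: (can_inj red2_natr). Qed.

Lemma lift_poly_monic p : p \is monic -> lift_poly p \is monic.
Proof.
rewrite !monicE /lift_poly lead_coef_map_inj //; first by move=> /eqP ->.
exact: can_inj red2_natr.
Qed.

Section Quotients.
Variables (g2 : {poly 'F_2}) (d : nat).
Hypotheses (d0 : (0 < d)%N) (sg : size g2 = d.+1).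

Lemma g2_monic : g2 \is monic.
Proof.
have : lead_coef g2 != 0 by rewrite lead_coef_eq0 -size_poly_gt0 sg.
by rewrite monicE; case: (lead_coef g2) => [[|[|//]] ?] // _; apply/eqP/val_inj.
Qed.

Lemma mk_monic_g2 : mk_monic g2 = g2.
Proof. by rewrite /mk_monic sg ltnS d0 g2_monic. Qed.

Lemma mk_monic_g4 : mk_monic (lift_poly g2) = lift_poly g2.
Proof. by rewrite /mk_monic size_lift_poly sg ltnS d0 (lift_poly_monic g2_monic). Qed.

Lemma four_E4d : 4%:R = 0 :> E4d g2.
Proof.
apply: val_inj; have /= -> := @qpolyC_natr _ (lift_poly g2) 4.
by rewrite -polyC_natr (_ : 4%:R = 0 :> 'Z_4) ?polyC0 //; apply: val_inj.
Qed.

Lemma redED (x y : E4d g2) : redE (x + y) = redE x + redE y.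
Proof. by rewrite /redE !red_polyE rmorphD in_qpolyD. Qed.

(** Reducing modulo the lifted polynomial first is harmless, as the lift itself reduces to [g2],
    which is 0 in the quotient. This is what makes [redE] multiplicative. *)
Lemma in_qpoly_red_rmodp (p : {poly 'Z_4}) :
  in_qpoly g2 (map_poly red2 (Pdiv.Ring.rmodp p (mk_monic (lift_poly g2)))) =
  in_qpoly g2 (map_poly red2 p).
Proof.
have g4m : lift_poly g2 \is monic := lift_poly_monic g2_monic.
rewrite mk_monic_g4 [in RHS](Pdiv.RingMonic.rdivp_eq g4m p) rmorphD rmorphM in_qpolyD in_qpolyM /=.
rewrite [map_poly red2 (lift_poly _)](red_lift_poly g2).
have -> : in_qpoly g2 g2 = 0.
  by apply: val_inj; rewrite /= mk_monic_g2 Pdiv.RingMonic.rmodpp // g2_monic.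
by rewrite mulr0 add0r.
Qed.

Lemma redEM (x y : E4d g2) : redE (x * y) = redE x * redE y.
Proof.
rewrite /redE !red_polyE -[RHS]in_qpolyM -rmorphM -[RHS]in_qpoly_red_rmodp.
by [].
Qed.

Lemma redE0 : redE (0 : E4d g2) = 0.
Proof. by rewrite /redE !red_polyE rmorph0 in_qpoly0. Qed.

Lemma redE1 : redE (1 : E4d g2) = 1.
Proof. by rewrite /redE !red_polyE rmorph1 in_qpoly1. Qed.

Lemma size_F2d (y : F2d g2) : (size (y : {poly %/ g2}) < size g2)%N.
Proof. by apply: leq_trans (size_mk_monic y) _; rewrite mk_monic_g2. Qed.

Lemma size_E4d (x : E4d g2) : (size (x : {poly %/ lift_poly g2}) < size g2)%N.
Proof. by apply: leq_trans (size_mk_monic x) _; rewrite mk_monic_g4 size_lift_poly. Qed.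

Lemma in_qpoly_g2 (p : {poly 'F_2}) : (size p < size g2)%N -> in_qpoly g2 p = p :> {poly 'F_2}.
Proof. by move=> lt; rewrite in_qpoly_small // mk_monic_g2. Qed.

Lemma in_qpoly_g4 (p : {poly 'Z_4}) : (size p < size g2)%N ->
  in_qpoly (lift_poly g2) p = p :> {poly 'Z_4}.
Proof. by move=> lt; rewrite in_qpoly_small // mk_monic_g4 size_lift_poly. Qed.

Lemma redE_lift (y : F2d g2) : redE (liftE y) = y.
Proof.
apply: val_inj; rewrite /redE /liftE [LHS]in_qpoly_g2 in_qpoly_g4 ?red_lift_poly ?size_lift_poly //.
all: exact: size_F2d.
Qed.

(** All coefficients of the representative are even; the witness halves them one by one. *)
Lemma redE_eq0 (x : E4d g2) : redE x = 0 -> exists y, x = 2%:R * y.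
Proof.
pose half (c : 'Z_4) : 'Z_4 := ((c : nat)./2)%:R.
move=> /(congr1 val); rewrite [LHS]in_qpoly_g2 => [rx|]; last first.
  exact: leq_ltn_trans (size_poly _ _) (size_E4d x).
exists (in_qpoly _ (map_poly half (x : {poly %/ lift_poly g2}))).
apply: val_inj; rewrite mulr_natl mulr2n [RHS]poly_of_qpolyD in_qpoly_g4; last first.
  exact: leq_ltn_trans (size_poly _ _) (size_E4d x).
apply/polyP => i; rewrite coefD coef_map_id0 //= -mulr2n -mulr_natl; apply: red2_even.
by have := congr1 (fun p : {poly 'F_2} => p`_i) rx; rewrite red_polyE coef_map coef0.
Qed.

Lemma F2d_unit (x : F2d g2) : irreducible_poly g2 -> x != 0 -> x \is a GRing.unit.
Proof.
move=> irr x0; rewrite -[_ \is a _]/(coprimep (mk_monic g2) (x : {poly %/ g2})).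
have -> : coprimep (mk_monic g2) (x : {poly %/ g2}) = coprimep g2 (x : {poly %/ g2}).
  by congr (coprimep _ _); exact: mk_monic_g2.
rewrite irreducible_poly_coprime //; apply/negP => dv.
have p0 : (x : {poly %/ g2}) != 0 :> {poly 'F_2} by apply: contraNneq x0 => x0; apply/eqP/val_inj.
by have := dvdp_leq p0 dv; rewrite leqNgt size_F2d.
Qed.

Lemma card_F2d : #|{: F2d g2}| = (2 ^ d)%N.
Proof.
have := @card_monic_qpoly _ g2; rewrite sg ltnS => /(_ d0 g2_monic) /=.
by rewrite card_Fp // => <-; apply: eq_card.
Qed.

(** One Newton step for the inverse of [a], starting from the lifted inverse of its residue. *)
Definition einv (a : E4d g2) : E4d g2 :=
  liftE (redE a)^-1 * (2%:R - a * liftE (redE a)^-1).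

(* If b lifts the inverse of the residue of a, then ab = 1 + z with z^2 = 0. *)
Lemma mul_einv (a : E4d g2) : irreducible_poly g2 -> redE a != 0 -> a * einv a = 1.
Proof.
move=> irr a0; rewrite /einv mulrA; set b := liftE _.
have [y Ey] : exists y, a * b - 1 = 2%:R * y.
  apply: redE_eq0; have rb : redE (a * b) = 1 by rewrite redEM redE_lift divrr ?F2d_unit.
  have : redE (a * b - 1 + 1) = 1 by rewrite subrK.
  by rewrite redED redE1 -[X in _ = X -> _]add0r => /addIr.
have -> : a * b = 1 + 2%:R * y by rewrite -Ey addrC subrK.
have -> : (1 + 2%:R * y) * (2%:R - (1 + 2%:R * y)) = 1 - 4%:R * y ^+ 2 by ring.
by rewrite four_E4d mul0r subr0.
Qed.
End Quotients.

(** * Interpolation *)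

Section Interpolation.
Variable R : comNzRingType.
Implicit Types p h : {poly R}.

(** Over a ring with zero divisors, roots can be split off successively only if their differences
    are units; [w] carries explicit inverses. *)
Lemma poly_eq0_roots n (y : nat -> R) (w : nat -> nat -> R) p :
  (forall s t, (s < n)%N -> (t < n)%N -> s != t -> (y s - y t) * w s t = 1) ->
  (size p <= n)%N -> (forall t, (t < n)%N -> p.[y t] = 0) -> p = 0.
Proof.
elim: n p => [|n IH] p inv sp rp; first by apply/eqP; rewrite -size_poly_leq0.
have /factor_theorem [q qE] : root p (y n) by apply/rootP/rp.
suff q0 : q = 0 by rewrite qE q0 mul0r.
apply: IH => [s t sn tn|| t tn]; first by apply: inv; apply: ltnW.
  have [->|q0] := eqVneq q 0; first by rewrite size_poly0.
  by move: sp; rewrite qE size_Mmonic ?monicXsubC // size_XsubC addn2 ltnS.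
have := rp t (ltnW tn); rewrite qE hornerM hornerXsubC => E.
by rewrite -[LHS]mulr1 -(inv t n (ltnW tn) (ltnSn n) (negbT (ltn_eqF tn))) mulrA E mul0r.
Qed.

(** The product of the ['X - y t] vanishes at all nodes and has the leading term of [h]. Their
    difference has degree below [n] and the same values as [h], so [n] nodes suffice for degree
    [n]. *)
Lemma lagrange_monic n (y : nat -> R) (w : nat -> nat -> R) h :
  (forall s t, (s < n)%N -> (t < n)%N -> s != t -> (y s - y t) * w s t = 1) ->
  h \is monic -> size h = n.+1 ->
  h.[0] = \sum_(t < n) h.[y t] * \prod_(s < n) (if s == t :> nat then 1 else y s * w s t)
          + \prod_(t < n) (0 - y t).
Proof.
move=> inv hm sh; pose P := \prod_(t < n) ('X - (y t)%:P).
have sP : size P = n.+1 by rewrite size_prod_XsubC /index_enum -enumT size_enum_ord.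
have Pm : P \is monic by apply: monic_prod_XsubC.
pose g := \sum_(t < n) h.[y t] *: \prod_(s < n) (if s == t :> nat then 1 else (w s t) *: ((y s)%:P - 'X)).
have P0 (t : nat) : (t < n)%N -> P.[y t] = 0.
  by move=> tn; rewrite horner_prod (bigD1 (Ordinal tn)) //= hornerXsubC subrr mul0r.
have sg : (size g <= n)%N.
  apply: leq_trans (size_sum _ _ _) _; apply/bigmax_leqP => t _.
  apply: leq_trans (size_scale_leq _ _) _; rewrite (bigD1 t) //= eqxx mul1r.
  apply: leq_trans (size_prod_leq _ _) _.
  rewrite leq_subLR; apply: leq_trans (_ : (\sum_(s < n | s != t) 2).+1 <= _)%N.
    rewrite ltnS; apply: leq_sum => s /negPf st; rewrite -val_eqE /= in st; rewrite st.
    apply: leq_trans (size_scale_leq _ _) _; rewrite -size_polyN opprB.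
    by rewrite size_XsubC.
  rewrite sum_nat_const; have := cardC1 t; rewrite card_ord => c.
  have -> : #|(fun s : 'I_n => s != t)| = n.-1 by rewrite -c; apply: eq_card.
  by have := ltn_ord t; lia.
have : h - P - g = 0.
  apply: (poly_eq0_roots inv) => [|t tn].
    apply: leq_trans (size_polyD _ _) _; rewrite size_polyN geq_max sg andbT.
    apply/leq_sizeP => j nj; rewrite coefB; case: (ltngtP n j) nj => // [nj|<-] _.
      by rewrite !nth_default ?subrr ?sh ?sP.
    by move: hm Pm; rewrite !monicE /lead_coef sh sP => /eqP -> /eqP ->; rewrite subrr.
  rewrite !hornerD !hornerN P0 // subr0; apply/eqP; rewrite subr_eq0 eq_sym; apply/eqP.
  rewrite horner_sum (bigD1 (Ordinal tn)) //= [X in _ + X = _]big1 ?addr0.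
    rewrite hornerZ horner_prod big1 ?mulr1 // => s _.
    case: eqP => [|/eqP st]; first by rewrite hornerC.
    by rewrite hornerZ !hornerE mulrC inv.
  move=> s st; rewrite hornerZ horner_prod (bigD1 (Ordinal tn)) //=.
  rewrite -val_eqE /= eq_sym in st; rewrite (negPf st) hornerZ !hornerE subrr.
  by rewrite /= mulr0 mul0r.
move/eqP; rewrite subr_eq0 subr_eq => /eqP /(congr1 (fun p => p.[0])); rewrite hornerD => ->.
congr (_ + _); last by rewrite horner_prod; apply: eq_bigr => t _; rewrite hornerXsubC.
rewrite horner_sum; apply: eq_bigr => t _; rewrite hornerZ horner_prod; congr (_ * _).
apply: eq_bigr => s _; case: eqP => _; first by rewrite hornerC.
by rewrite hornerZ !hornerE subr0 mulrC.
Qed.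

Definition permanent_poly n (A : 'M[R]_n) : {poly R} :=
  permanent (\matrix_(i, j) ((A i j)%:P + (i == j)%:R *: 'X)).

Lemma horner_permanent_poly n (A : 'M[R]_n) x :
  (permanent_poly A).[x] = permanent (\matrix_(i, j) (A i j + if i == j then x else 0)).
Proof.
rewrite /permanent_poly /permanent horner_sum; apply: eq_bigr => s _.
rewrite horner_prod; apply: eq_bigr => i _; rewrite !mxE !hornerE.
by case: eqP; rewrite ?mul1r ?mul0r.
Qed.

(** The identity permutation alone reaches degree [n]; any other one meets an off-diagonal, hence
    constant, entry. *)
Lemma permanent_poly_monic n (A : 'M[R]_n) :
  permanent_poly A \is monic /\ size (permanent_poly A) = n.+1.
Proof.
pose P := \prod_(i < n) ('X - (- A i i)%:P).
pose Q := \sum_(s : 'S_n | s != 1%g) \prod_(i < n) ((A i (s i))%:P + (i == s i)%:R *: 'X).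
have -> : permanent_poly A = P + Q.
  rewrite /permanent_poly /permanent (bigD1 1%g) //=; congr (_ + _).
    apply: eq_bigr => i _; rewrite mxE perm1 eqxx scale1r addrC.
    by rewrite polyCN opprK.
  by apply: eq_bigr => s _; apply: eq_bigr => i _; rewrite mxE.
have sP : size P = n.+1 by rewrite size_prod_XsubC /index_enum -enumT size_enum_ord.
have Pm : P \is monic by apply: monic_prod_XsubC.
have sQ : (size Q < n.+1)%N.
  rewrite ltnS; apply: leq_trans (size_sum _ _ _) _; apply/bigmax_leqP => s s1.
  have [i si] : exists i, i != s i.
    apply/existsP; apply: contraNT s1; rewrite negb_exists => /forallP sE.
    by apply/eqP/permP => i; have := sE i; rewrite negbK perm1 => /eqP.
  rewrite (bigD1 i) //= (negPf si) scale0r addr0 mul_polyC.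
  apply: leq_trans (size_scale_leq _ _) _.
  apply: leq_trans (size_prod_leq _ _) _.
  rewrite leq_subLR; apply: leq_trans (_ : (\sum_(j < n | j != i) 2).+1 <= _)%N.
    rewrite ltnS; apply: leq_sum => j _.
    apply: leq_trans (size_polyD _ _) _; rewrite geq_max (leq_trans (size_polyC_leq1 _)) //=.
    by apply: leq_trans (size_scale_leq _ _) _; rewrite size_polyX.
  rewrite sum_nat_const; have := cardC1 i; rewrite card_ord => c.
  have -> : #|(fun j : 'I_n => j != i)| = n.-1 by rewrite -c; apply: eq_card.
  by have := ltn_ord i; lia.
split; last by rewrite size_polyDl sP.
by move: Pm; rewrite !monicE lead_coefDl // sP.
Qed.
End Interpolation.

(** * Good evaluation points *)

Definition shifted (R : nzRingType) (A : nat -> nat -> R) (y : R) i j : R :=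
  A i j + (if i == j then y else 0).

(** The permanent at node [t], as given by [permanent_sweep], times the Lagrange weight of that node
    at 0. *)
Definition point_term (g2 : {poly 'F_2}) n (A : nat -> nat -> E4d g2) (y : nat -> E4d g2) (t : nat) : E4d g2 :=
  let B := shifted A (y t) in
  (\prod_(p < n) sweepU (@einv g2) B p p) * (1 + \sum_(i < n) (1 - \sum_(j < n) \sum_(k < n)
     (sweepL (@einv g2) B i j * sweepU (@einv g2) B j k * sweeps (@einv g2) B n k i) ^+ 2)) *
  \prod_(s < n) (if s == t :> nat then 1 else y s * einv (y s - y t)).

Section GoodPoints.
Variables (g2 : {poly 'F_2}) (d : nat).
Hypotheses (d0 : (0 < d)%N) (sg : size g2 = d.+1) (irr : irreducible_poly g2).
Variables (n : nat) (A : nat -> nat -> E4d g2).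

Definition good_point (x : F2d g2) : bool :=
  [forall k : 'I_n, \det (block k.+1 (shifted (fun i j => redE (A i j)) x)) != 0].

Lemma redE_zmod_morphism : zmod_morphism (@redE g2).
Proof.
move=> x y; apply: (@addIr _ (redE y)); rewrite -redED !subrK //.
Qed.

Lemma redE_det k (B : 'M[E4d g2]_k) : redE (\det B) = \det (map_mx (@redE g2) B).
Proof.
pose f : {rmorphism E4d g2 -> F2d g2} := HB.pack (@redE g2)
  (GRing.isZmodMorphism.Build _ _ _ redE_zmod_morphism)
  (GRing.isMonoidMorphism.Build _ _ _ (@redE1 g2, redEM d0 sg)).
exact: esym (det_map_mx f B).
Qed.

(** By strong induction the earlier pivots are good, so the leading minor of order [p.+1] is the
    product of the pivots up to [p]. As it is nonzero modulo 2, so is pivot [p], which is therefore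
    a unit. *)
Lemma good_point_pivot x p : good_point x -> (p < n)%N ->
  good_pivot (@einv g2) (shifted A (liftE x)) p.
Proof.
move=> /forallP good; elim/ltn_ind: p => p IH pn.
have := good (Ordinal pn) => /=.
have -> : block p.+1 (shifted (fun i j => redE (A i j)) x) =
   map_mx (@redE g2) (block p.+1 (shifted A (liftE x))).
  apply/matrixP => i j; rewrite !mxE /shifted redED; congr (_ + _).
  by case: eqP; rewrite ?(redE_lift d0 sg) ?redE0.
rewrite -redE_det (det_block (einv := @einv g2)) => [nz|q]; last first.
  by rewrite ltnS => qp; apply: IH => //; apply: ltn_trans pn.
apply: (mul_einv d0 sg irr); apply: contraNneq nz => r0.
rewrite (bigD1 (inord p)) //= inordK // /sweepU ltnn (redEM d0 sg) r0 mul0r //.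
Qed.

(** The leading minor of order [k.+1] is the characteristic polynomial of minus the leading block,
    evaluated at [x]; it has at most [k.+1] roots, and these bounds add up to n(n+1)/2. *)
Lemma card_bad_points : (2 * #|[set x | ~~ good_point x]| <= n * n.+1)%N.
Proof.
pose q (k : nat) := char_poly (- (block k.+1 (fun i j => redE (A i j)))).
have qE k x : (q k).[x] = \det (block k.+1 (shifted (fun i j => redE (A i j)) x)).
  rewrite /q /char_poly -[LHS]/(horner_eval x _) -det_map_mx; congr (\det _).
  apply/matrixP => i j; rewrite !mxE /shifted val_eqE.
  transitivity ('X *+ (i == j) - (- redE (A i j))%:P).[x] => //.
  rewrite hornerD hornerN hornerC opprK addrC.
  by congr (_ + _); case: eqP => _; rewrite ?mulr1n ?hornerX // mulr0n horner0.
have sq k : size (q k) = k.+2 by rewrite size_char_poly.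
pose Z k : {set F2d g2} := [set x | root (q k) x].
have cardq k : (#|Z k| <= k.+1)%N.
  have := @max_ring_poly_roots _ (q k) (enum (Z k)).
  rewrite -cardE sq ltnS; apply.
  - by rewrite -size_poly_gt0 sq.
  - by apply/allP => x; rewrite mem_enum inE.
  - have : uniq (enum (Z k)) by apply: enum_uniq.
    (* [F2d g2] carries only a ring structure, so the root bound asks for differences that are
       units. *)
    elim: (enum _) => //= x xs IH /andP[xn /IH ->]; rewrite andbT; apply/allP => y yxs.
    rewrite /diff_roots mulrC eqxx (F2d_unit d0 sg) // subr_eq0.
    by apply: contraNneq xn => <-.
have sub : (#|[set x | ~~ good_point x]| <= \sum_(k < n) #|Z k|)%N.
  rewrite -sum1_card; under [X in (_ <= X)%N]eq_bigr do rewrite -sum1_card big_mkcond /=.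
  rewrite exchange_big big_mkcond /=; apply: leq_sum => x _; rewrite inE.
  case: ifP => //; rewrite negb_forall => /existsP [k zk].
  have xk : x \in Z k by rewrite inE /root qE; move: zk; case: eqP.
  by rewrite lt0n sum_nat_eq0 negb_forall; apply/existsP; exists k; rewrite xk.
apply: leq_trans (leq_mul (leqnn 2) sub) _.
apply: (@leq_trans (2 * \sum_(k < n) k.+1)); first by rewrite leq_mul2l /= leq_sum.
clear; elim: n => [|m IH]; first by rewrite big_ord0.
by rewrite big_ord_recr /=; move: IH; move: (\sum_(k < m) _)%N => S; nia.
Qed.

Theorem permanent_good_points (r : nat -> F2d g2) :
  (forall t, (t < n)%N -> good_point (r t)) ->
  (forall s t, (s < n)%N -> (t < n)%N -> s != t -> r s != r t) ->
  let y t := liftE (r t) in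
  permanent (block n A) = \sum_(t < n) point_term n A y t + \prod_(t < n) (0 - y t).
Proof.
move=> good inj y.
have [hm sh] := permanent_poly_monic (block n A).
have -> : permanent (block n A) = (permanent_poly (block n A)).[0].
  rewrite horner_permanent_poly; congr permanent; apply/matrixP => i j.
  by rewrite !mxE; case: eqP; rewrite addr0.
rewrite (lagrange_monic (y := y) (w := fun s t => einv (y s - y t)) _ hm sh) => [|s t sn tn st].
  congr (_ + _); apply: eq_bigr => t _; rewrite /point_term; congr (_ * _).
  rewrite horner_permanent_poly -(permanent_sweep (four_E4d g2)) => [|p pn].
    by congr permanent; apply/matrixP => i j; rewrite !mxE.
  exact: good_point_pivot (good t (ltn_ord t)) pn.
apply: (mul_einv d0 sg irr); rewrite (redE_zmod_morphism _ _) !(redE_lift d0 sg).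
by rewrite subr_eq0 inj.
Qed.
End GoodPoints.

(** * Running time of machine programs *)

Section Cost.
Local Open Scope nat_scope.

(** Price of one instruction up to a constant: address arithmetic on numbers polynomial in [n],
    where products cost a product of bit lengths, and one ring operation. *)
Definition unit_cost (n tau : nat) : nat := bits n.+2 ^ 2 + tau + 1.

Lemma bits_exp n K v : v <= n.+2 ^ K -> bits v <= K.+1 * bits n.+2.
Proof.
move=> vK; have B : n.+2 < 2 ^ bits n.+2 by apply: trunc_log_ltn.
case: v vK => [|v] vK; first by rewrite /bits trunc_log0.
rewrite /bits; case: K vK => [|K] vK.
  by move: vK; rewrite expn0 ltnS leqn0 => /eqP ->; rewrite trunc_log1.
have lt : 2 ^ trunc_log 2 v.+1 < 2 ^ (bits n.+2 * K.+1).
  apply: leq_ltn_trans (trunc_logP _ _) _ => //; apply: leq_ltn_trans vK _.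
  by rewrite expnM ltn_exp2r.
rewrite ltn_exp2l // in lt; apply: leq_trans lt _.
by rewrite mulnC leq_mul2r leqnSn orbT.
Qed.

(** For a fixed expression over cells bounded by [n], the value is polynomial in [n], so every
    intermediate bit length is O(log n). One [K] serves as exponent and as cost factor. *)
Lemma iexp_bound (e : iexp) : exists K, forall n m, (forall c, m c <= n) ->
  ival m e <= n.+2 ^ K /\ icost m e <= K * bits n.+2 ^ 2.
Proof.
have b1 n : 1 <= bits n by [].
have b2 n : bits n <= bits n ^ 2 by rewrite -{1}[bits n]expn1 leq_pexp2l.
have b3 n : 1 <= bits n ^ 2 by apply: leq_trans (b2 n).
have pw n K : 0 < n.+2 ^ K by rewrite expn_gt0.
have mono n K K' : K <= K' -> n.+2 ^ K <= n.+2 ^ K' by apply: leq_pexp2l.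
elim: e => [c|a [K IH]|e1 [K1 IH1] e2 [K2 IH2]|e1 [K1 IH1] e2 [K2 IH2]|e1 [K1 IH1] e2 [K2 IH2]].
- exists c.+1 => n m mn; split => /=.
    by apply: leq_trans (mono n c c.+1 (leqnSn _)); apply/ltnW/ltn_expl.
  apply: leq_trans (bits_exp (ltnW (ltn_expl c (isT : 1 < n.+2)))) _.
  by rewrite leq_mul2l b2 orbT.
- exists (K + 2) => n m mn; have [v c] := IH n m mn; split => /=.
    apply: leq_trans (mn _) _; apply: (@leq_trans (n.+2 ^ 1)); first by rewrite expn1; lia.
    by apply: mono; rewrite addn2.
  rewrite mulnDl leq_add //; apply: (@leq_trans (2 * bits n.+2)); last by rewrite leq_mul2l b2.
  by apply: (bits_exp (K := 1)); rewrite expn1; apply: leq_trans (mn _) _; lia.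
- exists (K1 + K2 + (K1 + K2).+2) => n m mn; have [v1 c1] := IH1 n m mn; have [v2 c2] := IH2 n m mn.
  have v : ival m (IAdd e1 e2) <= n.+2 ^ (K1 + K2).+1.
    rewrite expnS expnD /=; have := pw n K1; have := pw n K2; nia.
  split; first by apply: leq_trans v _; apply: mono; lia.
  rewrite -/(icost m) [icost _ _]/= !mulnDl; apply: leq_add; first exact: leq_add.
  apply: leq_trans (bits_exp v) _; by rewrite leq_mul2l b2 orbT.
- exists (K1 + K2 + K1.+1) => n m mn; have [v1 c1] := IH1 n m mn; have [v2 c2] := IH2 n m mn.
  have v : ival m (ISub e1 e2) <= n.+2 ^ K1 by apply: leq_trans (leq_subr _ _) _.
  split; first by apply: leq_trans v _; apply: mono; lia.
  rewrite [icost _ _]/= !mulnDl; apply: leq_add; first exact: leq_add.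
  apply: leq_trans (bits_exp v) _; by rewrite leq_mul2l b2 orbT.
- exists (K1 + K2 + K1.+1 * K2.+1) => n m mn; have [v1 c1] := IH1 n m mn; have [v2 c2] := IH2 n m mn.
  split => /=; first by apply: leq_trans (leq_mul v1 v2) _; rewrite -expnD mono // leq_addr.
  rewrite !mulnDl; apply: leq_add; first exact: leq_add.
  apply: leq_trans (leq_mul (bits_exp v1) (bits_exp v2)) _.
  by rewrite mulnACA mulnn.
Qed.

Lemma step_cost_bound (i : instr) : exists K, forall n tau g2 (s : state g2),
  (forall c, imem s c <= n) -> step_cost tau s i <= K * unit_cost n tau.
Proof.
have H (es : seq iexp) : exists K, forall n m tau, (forall c, m c <= n) ->
    sumn [seq icost m e | e <- es] + tau + 1 <= K * unit_cost n tau.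
  elim: es => [|e es [K IH]].
    by exists 1 => n m tau _; rewrite /unit_cost /=; lia.
  have [K' IH'] := iexp_bound e.
  exists (K + K') => n m tau mn; have := IH n m tau mn; have [_] := IH' n m mn.
  by rewrite /unit_cost /=; nia.
case: i => [a e|a b|a b c|a b c|a b c|a b|a b c|a b c|a b c|a b|a b|a b].
all: try (have [K HK] := H [:: a; b; c]; exists K => n tau g2 s mn; have := HK n (imem s) tau mn; rewrite /=; lia).
- by have [K HK] := H [:: a; e]; exists K => n tau g2 s mn; have := HK n (imem s) tau mn; rewrite /=; lia.
- by have [K HK] := H [:: a]; exists K => n tau g2 s mn; have := HK n (imem s) tau mn; rewrite /=; lia.
- by have [K HK] := H [:: a]; exists K => n tau g2 s mn; have := HK n (imem s) tau mn; rewrite /=; lia.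
all: by have [K HK] := H [:: a; b]; exists K => n tau g2 s mn; have := HK n (imem s) tau mn; rewrite /=; lia.
Qed.

End Cost.

Lemma updE (V : Type) (m : nat -> V) a v x : upd m a v x = if x == a then v else m x.
Proof. by []. Qed.

Lemma upd_id (V : Type) (m : nat -> V) a v : m a = v -> upd m a v = m.
Proof. by move=> <-; apply/funext => x; rewrite updE; case: eqP => [->|]. Qed.

Lemma upd_upd (V : Type) (m : nat -> V) a v w : upd (upd m a v) a w = upd m a w.
Proof. by apply/funext => x; rewrite !updE; case: eqP. Qed.

(** * Total correctness with time bounds for commands and loops *)

Section Runs.
Variables (g2 : {poly 'F_2}) (tau : nat).
Implicit Types (s : state g2) (Q : state g2 -> Prop).

Definition runs c s (t : nat) Q :=
  exists t' s', [/\ exec tau c s t' s', (t' <= t)%N & Q s'].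

Lemma runs_weaken c s t1 t2 Q1 Q2 : runs c s t1 Q1 -> (t1 <= t2)%N ->
  (forall s', Q1 s' -> Q2 s') -> runs c s t2 Q2.
Proof.
move=> [t [s' [ex le q]]] le' QQ; exists t, s'; split=> //; last exact: QQ.
exact: leq_trans le'.
Qed.

Lemma runs_seq c1 c2 s t1 t2 Q1 Q2 : runs c1 s t1 Q1 ->
  (forall s', Q1 s' -> runs c2 s' t2 Q2) -> runs (CSeq c1 c2) s (t1 + t2)%N Q2.
Proof.
move=> [t [s1 [ex1 le1 q1]]] /(_ s1 q1) [t' [s2 [ex2 le2 q2]]].
by exists (t + t')%N, s2; split=> //; [apply: ExSeq ex1 ex2 | apply: leq_add].
Qed.

Lemma runs_instr i s t Q : (step_cost tau s i <= t)%N -> Q (step s i) ->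
  runs (CInstr i) s t Q.
Proof. by move=> le q; exists (step_cost tau s i), (step s i); split=> //; apply: ExInstr. Qed.

Lemma runs_if b c1 c2 s t u Q : (bcost tau s b <= t)%N ->
  (bval s b -> runs c1 s u Q) -> (~~ bval s b -> runs c2 s u Q) ->
  runs (CIf b c1 c2) s (t + u)%N Q.
Proof.
move=> le H1 H2; have [hb|hb] := boolP (bval s b).
  have [t' [s' [ex le' q]]] := H1 hb; exists (bcost tau s b + t')%N, s'; split=> //.
    exact: ExIfT.
  exact: leq_add.
have [t' [s' [ex le' q]]] := H2 hb; exists (bcost tau s b + t')%N, s'; split=> //.
  exact: ExIfF.
exact: leq_add.
Qed.
End Runs.

(* Loop variables live in the integer cells of the same number, and are 0 outside their loop. *)
Definition loop_env (n c : nat) (m : nat -> nat) :=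
  [/\ m 0 = n, forall a, (0 < a)%N -> (m a < n)%N & forall a, (c <= a)%N -> m a = 0].

Definition vdim := IMem (ICst 0).
(** The final reset gives back the integer memory as it was before the loop, so loops nest and
    follow one another under the same [loop_env]. *)
Definition loop (c : nat) (body : cmd) : cmd :=
  CSeq (CInstr (ISet (ICst c) (ICst 0)))
    (CSeq (CWhile (BLt (IMem (ICst c)) vdim)
             (CSeq body (CInstr (ISet (ICst c) (IAdd (IMem (ICst c)) (ICst 1))))))
          (CInstr (ISet (ICst c) (ICst 0)))).

Lemma loop_env_upd n c m i : (0 < c)%N -> loop_env n c m -> (i < n)%N -> loop_env n c.+1 (upd m c i).
Proof.
move=> c0 [m0 mlt mz] lt; split.
- by rewrite updE ifN // ltn_eqF.
- by move=> a a0; rewrite updE; case: eqP => // _; exact: mlt.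
- by move=> a ca; rewrite updE gtn_eqF // mz // ltnW.
Qed.

Lemma runs_loop c : (0 < c)%N -> exists K, forall n body g2 tau (s : state g2) t
  (I : nat -> state g2 -> Prop), (0 < n)%N -> loop_env n c (imem s) ->
  (forall i s1 m, I i s1 -> I i (set_imem s1 m)) ->
  (forall i s1, (i < n)%N -> imem s1 = upd (imem s) c i -> I i s1 ->
     runs tau body s1 t (fun s2 => imem s2 = imem s1 /\ I i.+1 s2)) ->
  I 0%N s ->
  runs tau (loop c body) s (n * (t + K * unit_cost n tau) + K * unit_cost n tau)%N
    (fun s' => imem s' = imem s /\ I n s').
Proof.
move=> c0; have [K1 H1] := step_cost_bound (ISet (ICst c) (ICst 0)).
have [K2 H2] := step_cost_bound (ISet (ICst c) (IAdd (IMem (ICst c)) (ICst 1))).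
(* The loop test costs exactly as much as this assignment, which is never executed. *)
have [K3 H3] := step_cost_bound (ISet (IMem (ICst c)) vdim).
exists (K1 + K1 + K2 + K3)%N => n body g2 tau s t I n0 [m0 mlt mz] Iset Ibody I0.
set u := unit_cost n tau.
have mle a : (imem s a <= n)%N by case: a => [|a]; rewrite ?m0 // ltnW // mlt.
have bnd i : (i <= n)%N -> forall a, (upd (imem s) c i a <= n)%N.
  by move=> le a; rewrite updE; case: eqP.
have cn0 : (0 == c)%N = false by rewrite ltn_eqF.
pose W := CWhile (BLt (IMem (ICst c)) vdim)
             (CSeq body (CInstr (ISet (ICst c) (IAdd (IMem (ICst c)) (ICst 1))))).
(* Induction on the number [j] of iterations left. *)
have while j : (j <= n)%N -> forall s1, imem s1 = upd (imem s) c (n - j)%N -> I (n - j)%N s1 ->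
    runs tau W s1 (j * (t + (K2 + K3) * u) + K3 * u)%N
      (fun s2 => imem s2 = upd (imem s) c n /\ I n s2).
  elim: j => [|j IH] jn s1 ms1 Is1.
    rewrite subn0 in ms1 Is1; exists (bcost tau s1 (BLt (IMem (ICst c)) vdim)), s1; split=> //.
      by apply: ExWhileF; rewrite /= ms1 !updE eqxx cn0 m0 ltnn.
    rewrite mul0n add0n /u; apply: leq_trans (H3 n tau g2 s1 _); first by rewrite /=; lia.
    by rewrite ms1; apply: bnd.
  have lt : (n - j.+1 < n)%N by lia.
  have Hc : (bcost tau s1 (BLt (IMem (ICst c)) vdim) <= K3 * u)%N.
    apply: leq_trans (H3 n tau g2 s1 _); first by rewrite /=; lia.
    by rewrite ms1; apply: bnd; apply: ltnW.
  have [t1 [s2 [ex1 le1 [ms2 Is2]]]] := Ibody _ _ lt ms1 Is1.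
  have eS : (n - j.+1).+1 = (n - j)%N by lia.
  pose s3 := step s2 (ISet (ICst c) (IAdd (IMem (ICst c)) (ICst 1))).
  have ms3 : imem s3 = upd (imem s) c (n - j)%N.
    by rewrite /s3 /= ms2 ms1 upd_upd updE eqxx addn1 eS.
  have [t2 [s4 [ex2 le2 q]]] := IH (ltnW jn) s3 ms3 (Iset _ _ _ (eq_rect _ (fun i => I i s2) Is2 _ eS)).
  exists (bcost tau s1 (BLt (IMem (ICst c)) vdim) +
     (t1 + step_cost tau s2 (ISet (ICst c) (IAdd (IMem (ICst c)) (ICst 1)))) + t2)%N, s4; split=> //.
    apply: ExWhileT ex2; first by rewrite /= ms1 !updE eqxx cn0 m0.
    by apply: ExSeq ex1 _; apply: ExInstr.
  have Hs : (step_cost tau s2 (ISet (ICst c) (IAdd (IMem (ICst c)) (ICst 1))) <= K2 * u)%N.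
    by apply: H2; rewrite ms2 ms1; apply: bnd; apply: ltnW.
  by clear -Hs Hc le1 le2; nia.
apply: (@runs_weaken _ _ _ _ (K1 * u + ((n * (t + (K2 + K3) * u) + K3 * u) + K1 * u))%N _
  (fun s' => imem s' = imem s /\ I n s')).
- apply: (runs_seq (Q1 := fun s' => imem s' = upd (imem s) c 0%N /\ I 0%N s')).
    by apply: runs_instr; [apply: H1 | split => //=; apply: Iset].
  move=> s1 [ms1 Is1].
  apply: (runs_seq (Q1 := fun s2 => imem s2 = upd (imem s) c n /\ I n s2)).
    by apply: while => //; rewrite subnn.
  move=> s2 [ms2 Is2]; apply: runs_instr.
    by apply: H1; rewrite ms2; apply: bnd.
  by split; [rewrite /= ms2 upd_upd upd_id ?mz | apply: Iset].
- have -> : (K1 + K1 + K2 + K3 = K1 + K1 + (K2 + K3))%N by lia.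
  rewrite !mulnDl !mulnDr; nia.
- by [].
Qed.

(** * A compiled array language *)

Inductive exp : Type :=
| Cell of nat & nat & nat
| Cst of bool
| Plus of exp & exp
| Minus of exp & exp
| Times of exp & exp
| LiftInv of exp
| IfEq of nat & nat & exp & exp
| IfLt of nat & nat & exp & exp
| Fold of bool & exp.

Definition store (g2 : {poly 'F_2}) := nat -> nat -> nat -> E4d g2.

Definition lift_inv (g2 : {poly 'F_2}) (x : E4d g2) : E4d g2 := liftE (redE x)^-1.

(* Variables are named by the integer cells that hold them; the one bound by [Fold] is [lv]. *)
Fixpoint eval (g2 : {poly 'F_2}) (n : nat) (sg : store g2) (lv : nat) (m : nat -> nat) (e : exp) : E4d g2 :=
  match e with
  | Cell k x y => sg k (m x) (m y)
  | Cst b => b%:R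
  | Plus e1 e2 => eval n sg lv m e1 + eval n sg lv m e2
  | Minus e1 e2 => eval n sg lv m e1 - eval n sg lv m e2
  | Times e1 e2 => eval n sg lv m e1 * eval n sg lv m e2
  | LiftInv e => lift_inv (eval n sg lv m e)
  | IfEq x y e1 e2 => if m x == m y then eval n sg lv m e1 else eval n sg lv m e2
  | IfLt x y e1 e2 => if (m x < m y)%N then eval n sg lv m e1 else eval n sg lv m e2
  | Fold prod e =>
      if prod then \prod_(i < n) eval n sg lv.+1 (upd m lv i) e
      else \sum_(i < n) eval n sg lv.+1 (upd m lv i) e
  end.

Fixpoint exp_depth (e : exp) : nat :=
  match e with
  | Cell _ _ _ | Cst _ => 0
  | Plus e1 e2 | Minus e1 e2 | Times e1 e2 | IfEq _ _ e1 e2 | IfLt _ _ e1 e2 =>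
      maxn (exp_depth e1) (exp_depth e2)
  | LiftInv e => exp_depth e
  | Fold _ e => (exp_depth e).+1
  end.

(** Cell 0 holds [n], which is out of range as an index; all other cells stay below [n]. *)
Fixpoint wf_exp (e : exp) : bool :=
  match e with
  | Cell k x y => [&& k < 8, 0 < x & 0 < y]%N
  | Cst _ => true
  | Plus e1 e2 | Minus e1 e2 | Times e1 e2 | IfEq _ _ e1 e2 | IfLt _ _ e1 e2 =>
      wf_exp e1 && wf_exp e2
  | LiftInv e | Fold _ e => wf_exp e
  end.

(* Memory layout: entry (i, j) of array [k < 8] is at address k n^2 + (i n + j),
   array 8 is a scratch copy, and temporaries are at multiples of n^2 from 9 n^2 on. *)
Definition vsqr := IMul vdim vdim.
Definition cell k x y := IAdd (IMul (ICst k) vsqr) (IAdd (IMul (IMem (ICst x)) vdim) (IMem (ICst y))).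
Definition temp l := IMul (ICst (9 + l)) vsqr.
Definition addr n k i j : nat := (k * (n * n) + (i * n + j))%N.
Definition taddr n l : nat := ((9 + l) * (n * n))%N.

(** The machine has no move instruction; clearing first and then adding requires distinct
    addresses. *)
Definition copy (a b : iexp) : cmd := CSeq (CInstr (EConst a false)) (CInstr (EAdd a a b)).

(** The value is left in temporary [l], and only memory from there on is touched. A pending left
    operand or accumulator is thus safe while the next subexpression uses [l.+1]. *)
Fixpoint compile_exp (lv l : nat) (e : exp) : cmd :=
  match e with
  | Cell k x y => copy (temp l) (cell k x y)
  | Cst b => CInstr (EConst (temp l) b)
  | Plus e1 e2 => CSeq (compile_exp lv l e1) (CSeq (compile_exp lv l.+1 e2)
      (CInstr (EAdd (temp l) (temp l) (temp l.+1))))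
  | Minus e1 e2 => CSeq (compile_exp lv l e1) (CSeq (compile_exp lv l.+1 e2)
      (CInstr (ESub (temp l) (temp l) (temp l.+1))))
  | Times e1 e2 => CSeq (compile_exp lv l e1) (CSeq (compile_exp lv l.+1 e2)
      (CInstr (EMul (temp l) (temp l) (temp l.+1))))
  | LiftInv e => CSeq (compile_exp lv l e) (CSeq (CInstr (ERed (ICst 0) (temp l)))
      (CSeq (CInstr (FInv (ICst 0) (ICst 0))) (CInstr (FLift (temp l) (ICst 0)))))
  | IfEq x y e1 e2 => CIf (BEq (IMem (ICst x)) (IMem (ICst y)))
      (compile_exp lv l e1) (compile_exp lv l e2)
  | IfLt x y e1 e2 => CIf (BLt (IMem (ICst x)) (IMem (ICst y)))
      (compile_exp lv l e1) (compile_exp lv l e2)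
  | Fold prod e => CSeq (CInstr (EConst (temp l) prod))
      (loop lv (CSeq (compile_exp lv.+1 l.+1 e)
        (CInstr ((if prod then EMul else EAdd) (temp l) (temp l) (temp l.+1)))))
  end.

Definition represents (g2 : {poly 'F_2}) n (mem : nat -> E4d g2) (sg : store g2) :=
  forall k i j, (k < 8)%N -> (i < n)%N -> (j < n)%N -> mem (addr n k i j) = sg k i j.

Lemma ival_cell n lv m k x y : loop_env n lv m -> ival m (cell k x y) = addr n k (m x) (m y).
Proof. by case=> m0 _ _; rewrite /cell /= m0. Qed.

Lemma ival_temp n lv m l : loop_env n lv m -> ival m (temp l) = taddr n l.
Proof. by case=> m0 _ _; rewrite /temp /= m0. Qed.

Opaque cell temp.

Lemma addr_lt n k i j : (i < n)%N -> (j < n)%N -> (addr n k i j < k.+1 * (n * n))%N.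
Proof.
move=> ni nj; rewrite /addr mulSn addnC ltn_add2r.
by apply: (@leq_trans (i.+1 * n)); [rewrite mulSn; lia | rewrite leq_mul2r ni orbT].
Qed.

Lemma taddr_lt n l : (0 < n)%N -> (taddr n l < taddr n l.+1)%N.
Proof. by move=> n0; rewrite ltn_mul2r addnS ltnSn muln_gt0 n0. Qed.

Lemma addr_temp n k i j l : (k < 9)%N -> (i < n)%N -> (j < n)%N -> (addr n k i j < taddr n l)%N.
Proof.
move=> k9 ni nj; apply: leq_trans (addr_lt _ ni nj) _.
by rewrite /taddr leq_mul2r (leq_trans k9 (leq_addr _ _)) orbT.
Qed.

Lemma represents_frame g2 n l (mem mem' : nat -> E4d g2) sg : 
  represents n mem sg -> (forall a, (a < taddr n l)%N -> mem' a = mem a) ->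
  represents n mem' sg.
Proof. by move=> rep fr k i j k8 ni nj; rewrite fr ?rep // addr_temp // ltnW. Qed.

Lemma loop_env_le n lv m c : (0 < n)%N -> loop_env n lv m -> (m c <= n)%N.
Proof. by move=> n0 [m0 mlt _]; case: c => [|c]; rewrite ?m0 // ltnW // mlt. Qed.

Lemma bcost_bound x y : exists K, forall n tau g2 (s : state g2) lv, (0 < n)%N -> loop_env n lv (imem s) ->
  (bcost tau s (BEq (IMem (ICst x)) (IMem (ICst y))) <= K * unit_cost n tau)%N /\
  (bcost tau s (BLt (IMem (ICst x)) (IMem (ICst y))) <= K * unit_cost n tau)%N.
Proof.
have [K HK] := step_cost_bound (ISet (IMem (ICst x)) (IMem (ICst y))).
exists K => n tau g2 s lv n0 env; have := HK n tau g2 s (fun c => loop_env_le c n0 env).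
by split.
Qed.

Definition exp_post (g2 : {poly 'F_2}) n (s : state g2) l v (s' : state g2) :=
  [/\ imem s' = imem s, emem s' (taddr n l) = v &
      forall a, (a < taddr n l)%N -> emem s' a = emem s a].

Lemma runs_binary (op : iexp -> iexp -> iexp -> instr) l : exists K,
  forall n tau g2 (s : state g2) (f : E4d g2 -> E4d g2 -> E4d g2) lv, (0 < n)%N -> loop_env n lv (imem s) ->
  (forall a b c, step s (op a b c) = set_emem s (upd (emem s) (ival (imem s) a)
     (f (emem s (ival (imem s) b)) (emem s (ival (imem s) c))))) ->
  runs tau (CInstr (op (temp l) (temp l) (temp l.+1))) s (K * unit_cost n tau)
    (exp_post n s l (f (emem s (taddr n l)) (emem s (taddr n l.+1)))).
Proof.
have [K HK] := step_cost_bound (op (temp l) (temp l) (temp l.+1)).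
exists K => n tau g2 s f lv n0 env opE; apply: runs_instr.
  by apply: HK => c; apply: loop_env_le env.
rewrite opE !(ival_temp _ env); split=> //=; first by rewrite updE eqxx.
by move=> a lt; rewrite updE ltn_eqF.
Qed.

Lemma compile_binary_ok (op : iexp -> iexp -> iexp -> instr)
  (f : forall g2, E4d g2 -> E4d g2 -> E4d g2) lv l c1 c2 d1 d2
  (ev1 ev2 : forall g2 : {poly 'F_2}, nat -> (nat -> nat) -> store g2 -> E4d g2) :
  (forall g2 (s : state g2) a b c, step s (op a b c) = set_emem s (upd (emem s) (ival (imem s) a)
     (f g2 (emem s (ival (imem s) b)) (emem s (ival (imem s) c))))) ->
  (exists K, forall n tau g2 (s : state g2) sg, (0 < n)%N -> loop_env n lv (imem s) ->
    represents n (emem s) sg ->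
    runs tau c1 s (K * n ^ d1 * unit_cost n tau) (exp_post n s l (ev1 g2 n (imem s) sg))) ->
  (exists K, forall n tau g2 (s : state g2) sg, (0 < n)%N -> loop_env n lv (imem s) ->
    represents n (emem s) sg ->
    runs tau c2 s (K * n ^ d2 * unit_cost n tau) (exp_post n s l.+1 (ev2 g2 n (imem s) sg))) ->
  exists K, forall n tau g2 (s : state g2) sg, (0 < n)%N -> loop_env n lv (imem s) ->
    represents n (emem s) sg ->
    runs tau (CSeq c1 (CSeq c2 (CInstr (op (temp l) (temp l) (temp l.+1))))) s
      (K * n ^ maxn d1 d2 * unit_cost n tau)
      (exp_post n s l (f g2 (ev1 g2 n (imem s) sg) (ev2 g2 n (imem s) sg))).
Proof.
move=> opE [K1 H1] [K2 H2]; have [K3 H3] := runs_binary op l.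
exists (K1 + (K2 + K3))%N => n tau g2 s sg n0 env rep.
apply: (@runs_weaken _ _ _ _ (K1 * n ^ d1 * unit_cost n tau +
   (K2 * n ^ d2 * unit_cost n tau + K3 * unit_cost n tau))%N _ _ _ _ _ (fun s' h => h)).
  apply: runs_seq (H1 n tau g2 s sg n0 env rep) _ => s1 [ms1 v1 fr1].
  have env1 : loop_env n lv (imem s1) by rewrite ms1.
  have rep1 := represents_frame rep fr1.
  apply: runs_seq (H2 n tau g2 s1 sg n0 env1 rep1) _ => s2 [ms2 v2 fr2].
  have env2 : loop_env n lv (imem s2) by rewrite ms2.
  apply: runs_weaken (H3 n tau g2 s2 (f g2) lv n0 env2 (opE g2 s2)) (leqnn _) _ => s3 [ms3 v3 fr3].
  split; first by rewrite ms3 ms2 ms1.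
    by rewrite v3 v2 fr2 ?taddr_lt // v1 ms1.
  move=> a lt; rewrite fr3 // fr2 ?fr1 //.
  by apply: ltn_trans lt _; apply: taddr_lt.
rewrite !mulnDl.
have p1 : (n ^ d1 <= n ^ maxn d1 d2)%N by apply: leq_pexp2l; rewrite ?leq_maxl.
have p2 : (n ^ d2 <= n ^ maxn d1 d2)%N by apply: leq_pexp2l; rewrite ?leq_maxr.
have p3 : (0 < n ^ maxn d1 d2)%N by rewrite expn_gt0 n0.
apply: leq_add; first by rewrite leq_mul2r leq_mul2l p1 !orbT.
apply: leq_add; first by rewrite leq_mul2r leq_mul2l p2 !orbT.
by rewrite leq_mul2r leq_pmulr ?orbT.
Qed.

Lemma runs_copy a b : exists K, forall n tau g2 (s : state g2) lv, (0 < n)%N -> loop_env n lv (imem s) ->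
  ival (imem s) a != ival (imem s) b ->
  runs tau (copy a b) s (K * unit_cost n tau) (fun s' => imem s' = imem s /\
    emem s' = upd (emem s) (ival (imem s) a) (emem s (ival (imem s) b))).
Proof.
have [K1 H1] := step_cost_bound (EConst a false); have [K2 H2] := step_cost_bound (EAdd a a b).
exists (K1 + K2)%N => n tau g2 s lv n0 env ab; rewrite mulnDl.
apply: (runs_seq (Q1 := fun s' => s' = set_emem s (upd (emem s) (ival (imem s) a) 0))).
  by apply: runs_instr => //; apply: H1 => c; apply: loop_env_le env.
move=> _ ->; apply: runs_instr; first by apply: H2 => c; apply: loop_env_le env.
by split=> //=; rewrite upd_upd !updE eqxx add0r eq_sym (negPf ab).
Qed.

(** [K] is chosen before [n], [tau] and [g2]; each [Fold] contributes one factor [n]. Positivity of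
    [lv] keeps loop counters away from the cell holding [n]. *)
Lemma compile_exp_ok e lv l : (0 < lv)%N -> wf_exp e ->
  exists K, forall n tau g2 (s : state g2) sg, (0 < n)%N -> loop_env n lv (imem s) ->
    represents n (emem s) sg ->
    runs tau (compile_exp lv l e) s (K * n ^ exp_depth e * unit_cost n tau)
      (exp_post n s l (eval n sg lv (imem s) e)).
Proof.
elim: e lv l => [k x y|b|e1 IH1 e2 IH2|e1 IH1 e2 IH2|e1 IH1 e2 IH2|e IH|x y e1 IH1 e2 IH2|x y e1 IH1 e2 IH2|prod e IH] lv l lv0 /=.
- case/and3P=> k8 x0 y0; have [K H] := runs_copy (temp l) (cell k x y).
  exists K => n tau g2 s sg n0 env rep; rewrite expn0 muln1.
  have [_ mlt _] := env.
  apply: runs_weaken (H n tau g2 s lv n0 env _) (leqnn _) _.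
    by rewrite (ival_temp _ env) (ival_cell _ _ _ env) gtn_eqF // addr_temp ?mlt // ltnW.
  move=> s' [ms' es']; split=> //; rewrite es' (ival_temp _ env) (ival_cell _ _ _ env).
    by rewrite updE eqxx rep ?mlt.
  by move=> a lt; rewrite updE ltn_eqF.
- have [K H] := step_cost_bound (EConst (temp l) b) => _.
  exists K => n tau g2 s sg n0 env rep; rewrite expn0 muln1; apply: runs_instr.
    by apply: H => c; apply: loop_env_le env.
  split=> //=; rewrite (ival_temp _ env) ?updE ?eqxx //.
  by move=> a lt; rewrite updE ltn_eqF.
- case/andP=> w1 w2; apply: (compile_binary_ok (f := fun g2 x y => x + y)
    (ev1 := fun g2 n m sg => eval n sg lv m e1) (ev2 := fun g2 n m sg => eval n sg lv m e2)) => //; auto.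
- case/andP=> w1 w2; apply: (compile_binary_ok (f := fun g2 x y => x - y)
    (ev1 := fun g2 n m sg => eval n sg lv m e1) (ev2 := fun g2 n m sg => eval n sg lv m e2)) => //; auto.
- case/andP=> w1 w2; apply: (compile_binary_ok (f := fun g2 x y => x * y)
    (ev1 := fun g2 n m sg => eval n sg lv m e1) (ev2 := fun g2 n m sg => eval n sg lv m e2)) => //; auto.
- move=> we; have [K H] := IH lv l lv0 we.
  have [K1 H1] := step_cost_bound (ERed (ICst 0) (temp l)).
  have [K2 H2] := step_cost_bound (FInv (ICst 0) (ICst 0)).
  have [K3 H3] := step_cost_bound (FLift (temp l) (ICst 0)).
  exists (K + (K1 + (K2 + K3)))%N => n tau g2 s sg n0 env rep.
  apply: (@runs_weaken _ _ _ _ (K * n ^ exp_depth e * unit_cost n tau +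
    (K1 * unit_cost n tau + (K2 * unit_cost n tau + K3 * unit_cost n tau)))%N _ _ _ _ _ (fun s' h => h)).
    apply: runs_seq (H n tau g2 s sg n0 env rep) _ => s1 [ms1 v1 fr1].
    have env1 : loop_env n lv (imem s1) by rewrite ms1.
    have le1 c : (imem s1 c <= n)%N by apply: loop_env_le env1.
    apply: (runs_seq (Q1 := fun s' => s' = step s1 (ERed (ICst 0) (temp l)))).
      by apply: runs_instr => //; apply: H1.
    move=> _ ->.
    apply: (runs_seq (Q1 := fun s' => s' = step (step s1 (ERed (ICst 0) (temp l))) (FInv (ICst 0) (ICst 0)))).
      by apply: runs_instr => //; apply: H2.
    move=> _ ->; apply: runs_instr; first exact: H3.
    have te := ival_temp l env1; split; first exact: ms1.
      by rewrite /= !updE !te eqxx v1.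
    by move=> a lt; rewrite /= te updE ltn_eqF // fr1.
  rewrite !mulnDl; have p3 : (0 < n ^ exp_depth e)%N by rewrite expn_gt0 n0.
  by rewrite !leq_add // leq_mul2r leq_pmulr ?orbT.
- case/andP=> w1 w2; have [K1 H1] := IH1 lv l lv0 w1; have [K2 H2] := IH2 lv l lv0 w2.
  have [K H] := bcost_bound x y; exists (K + (K1 + K2))%N => n tau g2 s sg n0 env rep.
  apply: (@runs_weaken _ _ _ _ (K * unit_cost n tau +
    (K1 * n ^ exp_depth e1 * unit_cost n tau + K2 * n ^ exp_depth e2 * unit_cost n tau))%N _ _ _ _ _ (fun s' h => h)).
    apply: runs_if => [|/= ->|/= /negPf ->]; first by case: (H n tau g2 s lv n0 env).
      by apply: runs_weaken (H1 n tau g2 s sg n0 env rep) (leq_addr _ _) _.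
    by apply: runs_weaken (H2 n tau g2 s sg n0 env rep) (leq_addl _ _) _.
  rewrite !mulnDl; have p1 : (n ^ exp_depth e1 <= n ^ maxn (exp_depth e1) (exp_depth e2))%N.
    by apply: leq_pexp2l; rewrite ?leq_maxl.
  have p2 : (n ^ exp_depth e2 <= n ^ maxn (exp_depth e1) (exp_depth e2))%N.
    by apply: leq_pexp2l; rewrite ?leq_maxr.
  have p3 : (0 < n ^ maxn (exp_depth e1) (exp_depth e2))%N by rewrite expn_gt0 n0.
  by rewrite !leq_add // leq_mul2r ?leq_mul2l ?p1 ?p2 ?leq_pmulr ?orbT.
- case/andP=> w1 w2; have [K1 H1] := IH1 lv l lv0 w1; have [K2 H2] := IH2 lv l lv0 w2.
  have [K H] := bcost_bound x y; exists (K + (K1 + K2))%N => n tau g2 s sg n0 env rep.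
  apply: (@runs_weaken _ _ _ _ (K * unit_cost n tau +
    (K1 * n ^ exp_depth e1 * unit_cost n tau + K2 * n ^ exp_depth e2 * unit_cost n tau))%N _ _ _ _ _ (fun s' h => h)).
    apply: runs_if => [|/= ->|/= /negPf ->]; first by case: (H n tau g2 s lv n0 env).
      by apply: runs_weaken (H1 n tau g2 s sg n0 env rep) (leq_addr _ _) _.
    by apply: runs_weaken (H2 n tau g2 s sg n0 env rep) (leq_addl _ _) _.
  rewrite !mulnDl; have p1 : (n ^ exp_depth e1 <= n ^ maxn (exp_depth e1) (exp_depth e2))%N.
    by apply: leq_pexp2l; rewrite ?leq_maxl.
  have p2 : (n ^ exp_depth e2 <= n ^ maxn (exp_depth e1) (exp_depth e2))%N.
    by apply: leq_pexp2l; rewrite ?leq_maxr.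
  have p3 : (0 < n ^ maxn (exp_depth e1) (exp_depth e2))%N by rewrite expn_gt0 n0.
  by rewrite !leq_add // leq_mul2r ?leq_mul2l ?p1 ?p2 ?leq_pmulr ?orbT.
- move=> we; have [K H] := IH lv.+1 l.+1 (ltn0Sn _) we.
  have [K1 H1] := step_cost_bound (EConst (temp l) prod).
  have [K2 H2] := runs_binary (if prod then EMul else EAdd) l.
  have [K3 H3] := runs_loop lv0.
  exists (K + K1 + K2 + 2 * K3)%N => n tau g2 s sg n0 env rep.
  pose F i := eval n sg lv.+1 (upd (imem s) lv i) e.
  pose part i := if prod then \prod_(j < i) F j else \sum_(j < i) F j.
  pose I i (s' : state g2) := emem s' (taddr n l) = part i /\ forall a, (a < taddr n l)%N -> emem s' a = emem s a.
  pose body := CSeq (compile_exp lv.+1 l.+1 e) (CInstr ((if prod then EMul else EAdd) (temp l) (temp l) (temp l.+1))).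
  set u := unit_cost n tau.
  apply: (@runs_weaken _ _ _ _ (K1 * u + (n * ((K * n ^ exp_depth e * u + K2 * u) + K3 * u) + K3 * u))%N _
    (fun s' => imem s' = imem s /\ I n s')).
  + apply: (runs_seq (Q1 := fun s' => s' = step s (EConst (temp l) prod))).
      by apply: runs_instr => //; apply: H1 => c; apply: loop_env_le env.
    move=> _ ->; apply: (H3 n body g2 tau _ _ I n0) => //.
    * move=> i s1 lt ms1 [v1 fr1]; rewrite /= in ms1.
      have env1 : loop_env n lv.+1 (imem s1) by rewrite ms1; apply: loop_env_upd.
      have rep1 := represents_frame rep fr1.
      apply: runs_seq (H n tau g2 s1 sg n0 env1 rep1) _ => s2 [ms2 v2 fr2].
      have env2 : loop_env n lv.+1 (imem s2) by rewrite ms2.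
      apply: runs_weaken (H2 n tau g2 s2 (fun x y => if prod then x * y else x + y) lv.+1 n0 env2 _) (leqnn _) _.
        by move=> a b c; case: (prod).
      move=> s3 [ms3 v3 fr3]; split; first by rewrite ms3 ms2.
      split.
        rewrite v3 v2 fr2 ?taddr_lt // v1 ms1 /part /F.
        by case: (prod); rewrite big_ord_recr.
      move=> a lta; rewrite fr3 // fr2 ?fr1 //.
      by apply: ltn_trans lta _; apply: taddr_lt.
    * rewrite /I /= (ival_temp _ env); split.
        by rewrite updE eqxx /part; case: (prod); rewrite big_ord0.
      by move=> a lta; rewrite updE ltn_eqF.
  + have p3 : (0 < n ^ exp_depth e)%N by rewrite expn_gt0 n0.
    rewrite expnS; clearbody u; move: (n ^ exp_depth e)%N p3 => q q0.
    apply: (@leq_trans (K1 * (n * q) * u + (n * ((K * q * u + K2 * q * u) + K3 * q * u) + K3 * (n * q) * u)))%N.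
      have q1 : (1 <= n * q)%N by rewrite muln_gt0 n0.
      have h r K' : (0 < r)%N -> (K' * u <= K' * r * u)%N.
        by move=> r0; rewrite leq_mul2r leq_pmulr ?orbT.
      apply: leq_add; first exact: h.
      apply: leq_add; last exact: h.
      rewrite leq_mul2l; apply/orP; right; rewrite -!addnA leq_add2l.
      by apply: leq_add; apply: h.
    by apply: eq_leq; lia.
  + by move=> s' [ms' [v' fr']]; split=> //; rewrite v' /part /F.
Qed.

(** * Statements: tables, sequencing and counted loops *)

Inductive stm : Type :=
| Tab of nat & exp
| Then of stm & stm
| For of stm.

(* In [Tab k e] the variables [lv] and [lv.+1] are the row and the column of the entry of
   array k; all entries are computed before any is stored. *)
Fixpoint run (g2 : {poly 'F_2}) (n lv : nat) (m : nat -> nat) (st : stm) (sg : store g2) : store g2 :=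
  match st with
  | Tab k e => fun k' i j =>
      if k' == k then eval n sg lv.+2 (upd (upd m lv i) lv.+1 j) e else sg k' i j
  | Then st1 st2 => run n lv m st2 (run n lv m st1 sg)
  | For st => iteri n (fun i => run n lv.+1 (upd m lv i) st) sg
  end.

Fixpoint stm_depth (st : stm) : nat :=
  match st with
  | Tab _ e => (exp_depth e).+2
  | Then st1 st2 => maxn (stm_depth st1) (stm_depth st2)
  | For st => (stm_depth st).+1
  end.

Fixpoint wf_stm (st : stm) : bool :=
  match st with
  | Tab k e => (k < 8)%N && wf_exp e
  | Then st1 st2 => wf_stm st1 && wf_stm st2
  | For st => wf_stm st
  end.

Definition loop2 lv body := loop lv (loop lv.+1 body).

Fixpoint compile (lv : nat) (st : stm) : cmd :=
  match st with
  | Tab k e => CSeq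
      (loop2 lv (CSeq (compile_exp lv.+2 0 e) (copy (cell 8 lv lv.+1) (temp 0))))
      (loop2 lv (copy (cell k lv lv.+1) (cell 8 lv lv.+1)))
  | Then st1 st2 => CSeq (compile lv st1) (compile lv st2)
  | For st => loop lv (compile lv.+1 st)
  end.

Lemma runs_loop2 c : (0 < c)%N -> exists K, forall n body g2 tau (s : state g2) t
  (I : nat -> nat -> state g2 -> Prop), (0 < n)%N -> loop_env n c (imem s) ->
  (forall i j s1 m, I i j s1 -> I i j (set_imem s1 m)) ->
  (forall i s1, I i n s1 -> I i.+1 0%N s1) ->
  (forall i j s1, (i < n)%N -> (j < n)%N -> imem s1 = upd (upd (imem s) c i) c.+1 j -> I i j s1 ->
     runs tau body s1 t (fun s2 => imem s2 = imem s1 /\ I i j.+1 s2)) ->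
  I 0%N 0%N s ->
  runs tau (loop2 c body) s (n ^ 2 * (t + K * unit_cost n tau))%N
    (fun s' => imem s' = imem s /\ I n 0%N s').
Proof.
move=> c0; have [K1 H1] := runs_loop c0; have [K2 H2] := runs_loop (ltn0Sn c).
exists (K1 + K1 + K2 + K2)%N => n body g2 tau s t I n0 env Iset Inext Ibody I0.
set u := unit_cost n tau.
apply: runs_weaken (H1 n _ g2 tau s (n * (t + K2 * u) + K2 * u)%N (fun i => I i 0%N) n0 env (fun i => Iset i 0%N) _ I0) _ _ => //.
  move=> i s1 lt ms1 Is1.
  have env1 : loop_env n c.+1 (imem s1) by rewrite ms1; apply: loop_env_upd.
  apply: runs_weaken (H2 n _ g2 tau s1 t (I i) n0 env1 (Iset i) _ Is1) (leqnn _) _ => //.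
    by move=> j s2 ltj ms2; apply: Ibody => //; rewrite ms2 ms1.
  by move=> s2 [ms2 /Inext].
rewrite -/u; clearbody u; clear -n0; nia.
Qed.

Lemma addr_inj n k i j k' i' j' : (i < n)%N -> (j < n)%N -> (i' < n)%N -> (j' < n)%N ->
  (addr n k i j == addr n k' i' j') = [&& k == k', i == i' & j == j'].
Proof.
move=> ni nj ni' nj'; apply/eqP/and3P => [E|[/eqP-> /eqP-> /eqP->]//].
have n0 : (0 < n)%N by apply: leq_ltn_trans ni.
have lt a b : (a < n)%N -> (b < n)%N -> (a * n + b < n * n)%N.
  by move=> an bn; have := addr_lt 0 an bn; rewrite /addr mul0n add0n mul1n.
have Ek : k = k'.
  have := congr1 (fun x => x %/ (n * n))%N E; rewrite /addr !divnMDl ?muln_gt0 ?n0 //.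
  by rewrite !divn_small ?lt // !addn0.
move: E; rewrite Ek => /addnI E.
have Ei : i = i'.
  by have := congr1 (fun x => x %/ n)%N E; rewrite !divnMDl // !divn_small // !addn0.
by move: E; rewrite Ei => /addnI ->; rewrite !eqxx.
Qed.

Lemma compile_tab_ok k e lv : (0 < lv)%N -> (k < 8)%N -> wf_exp e ->
  exists K, forall n tau g2 (s : state g2) sg, (0 < n)%N -> loop_env n lv (imem s) ->
    represents n (emem s) sg ->
    runs tau (compile lv (Tab k e)) s (K * n ^ (exp_depth e).+2 * unit_cost n tau)
      (fun s' => imem s' = imem s /\ represents n (emem s') (run n lv (imem s) (Tab k e) sg)).
Proof.
move=> lv0 k8 we; have [K1 H1] := compile_exp_ok 0 (ltn0Sn lv.+1) we.
have [K2 H2] := runs_copy (cell 8 lv lv.+1) (temp 0).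
have [K3 H3] := runs_copy (cell k lv lv.+1) (cell 8 lv lv.+1).
have [K4 H4] := runs_loop2 lv0.
exists (K1 + K2 + K3 + 2 * K4)%N => n tau g2 s sg n0 env rep.
set u := unit_cost n tau.
pose v i j := eval n sg lv.+2 (upd (upd (imem s) lv i) lv.+1 j) e.
have env2 i j (s1 : state g2) : (i < n)%N -> (j < n)%N ->
    imem s1 = upd (upd (imem s) lv i) lv.+1 j -> loop_env n lv.+2 (imem s1).
  by move=> ni nj ->; do 2! apply: loop_env_upd => //.
have idx i j k' (s1 : state g2) : (i < n)%N -> (j < n)%N -> imem s1 = upd (upd (imem s) lv i) lv.+1 j ->
    ival (imem s1) (cell k' lv lv.+1) = addr n k' i j.
  move=> ni nj ms1; rewrite (ival_cell _ _ _ (env2 i j s1 ni nj ms1)) ms1 !updE eqxx.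
  by rewrite ltn_eqF // eqxx.
(* The entries visited before [(i, j)] in row-major order. [I1] describes the pass filling the
   scratch array, [I2] the pass copying it into array [k]. *)
pose done i j i' j' := (i' < i)%N || (i' == i) && (j' < j)%N.
have doneS i j i' j' : (j' < n)%N -> done i j.+1 i' j' = done i j i' j' || (i' == i) && (j' == j).
  by rewrite /done ltnS (leq_eqVlt j') andb_orr; case: (i' < i)%N; rewrite //= orbC.
pose I1 i j (s' : state g2) := represents n (emem s') sg /\
  forall i' j', (i' < n)%N -> (j' < n)%N -> done i j i' j' -> emem s' (addr n 8 i' j') = v i' j'.
pose I2 i j (s' : state g2) :=
  (forall i' j', (i' < n)%N -> (j' < n)%N -> emem s' (addr n 8 i' j') = v i' j') /\
  represents n (emem s') (fun k' i' j' => if (k' == k) && done i j i' j' then v i' j' else sg k' i' j').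
have doneN i i' j' : (j' < n)%N -> done i n i' j' = done i.+1 0%N i' j'.
  by move=> nj; rewrite /done nj andbT ltn0 andbF orbF ltnS (leq_eqVlt i') orbC.
apply: (@runs_weaken _ _ _ _ (n ^ 2 * (K1 * n ^ exp_depth e * u + K2 * u + K4 * u) +
    n ^ 2 * (K3 * u + K4 * u))%N _ (fun s' => imem s' = imem s /\ I2 n 0%N s')).
- apply: (runs_seq (Q1 := fun s' => imem s' = imem s /\ I1 n 0%N s')).
    apply: (H4 n _ g2 tau s _ I1 n0 env) => //.
    + move=> i s1 [rep1 H]; split=> // i' j' ni' nj' d; apply: H => //; by rewrite doneN.
    + move=> i j s1 ni nj ms1 [rep1 H].
      apply: runs_seq (H1 n tau g2 s1 sg n0 (env2 i j s1 ni nj ms1) rep1) _ => s2 [ms2 v2 fr2].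
      have ms2' : imem s2 = upd (upd (imem s) lv i) lv.+1 j by rewrite ms2.
      have env2' := env2 i j s2 ni nj ms2'.
      apply: runs_weaken (H2 n tau g2 s2 lv.+2 n0 env2' _) (leqnn _) _.
        by rewrite (idx i j) // (ival_temp _ env2') ltn_eqF // addr_temp.
      move=> s3 [ms3 es3]; split; first by rewrite ms3 ms2.
      rewrite (idx i j) // (ival_temp _ env2') v2 ms1 in es3; rewrite /I1 es3; split.
        move=> k' i' j' k8' ni' nj'; rewrite updE addr_inj // (ltn_eqF k8') /=.
        by rewrite fr2 ?rep1 // addr_temp // ltnW.
      move=> i' j' ni' nj'; rewrite doneS // updE addr_inj // eqxx /=.
      case: andP => [[/eqP-> /eqP->]//|_]; rewrite orbF => d.
      by rewrite fr2 ?H // addr_temp.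
    + by split=> // i' j' _ _; rewrite /done ltn0 andbF.
  move=> s1 [ms1 [rep1 H]].
  have env1 : loop_env n lv (imem s1) by rewrite ms1.
  apply: runs_weaken (H4 n _ g2 tau s1 _ I2 n0 env1 _ _ _ _) (leqnn _) _ => //.
  + move=> i s2 [H' rep2]; split=> // k' i' j' k8' ni' nj'.
    by rewrite rep2 // doneN.
  + move=> i j s2 ni nj ms2 [H' rep2]; rewrite ms1 in ms2.
    apply: runs_weaken (H3 n tau g2 s2 lv.+2 n0 (env2 i j s2 ni nj ms2) _) (leqnn _) _.
      by rewrite !(idx i j) // addr_inj // (ltn_eqF k8).
    move=> s3 [ms3 es3]; split=> //; rewrite !(idx i j) // in es3; rewrite /I2 es3; split.
      by move=> i' j' ni' nj'; rewrite updE addr_inj // (gtn_eqF k8) /= H'.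
    move=> k' i' j' k8' ni' nj'; rewrite updE addr_inj // doneS //.
    case: (eqVneq k' k) => [->|/negPf nk]; last by rewrite /= rep2 // nk.
    rewrite /=; case: andP => [[/eqP-> /eqP->]|_]; first by rewrite orbT H'.
    by rewrite orbF rep2 // eqxx.
  + split=> [i' j' ni' nj'|k' i' j' k8' ni' nj']; first by rewrite H // /done ni'.
    by rewrite /done !ltn0 !andbF rep1.
  + by move=> s2 [ms2 q]; rewrite ms2 ms1.
- have q0 : (0 < n ^ exp_depth e)%N by rewrite expn_gt0 n0.
  rewrite !expnS expn0 muln1; move: (n ^ exp_depth e)%N q0 => q q0; clearbody u.
  have h K' : (K' * u <= K' * q * u)%N by rewrite leq_mul2r leq_pmulr ?orbT.
  apply: (@leq_trans (n * n * (K1 * q * u + K2 * q * u + K4 * q * u) + n * n * (K3 * q * u + K4 * q * u))%N).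
    by apply: leq_add; rewrite leq_mul2l ?leq_add ?h ?orbT.
  by apply: eq_leq; lia.
- move=> s' [ms' [_ rep']]; split=> // k' i' j' k8' ni' nj'; rewrite rep' //.
  by rewrite /done ni' andbT.
Qed.

Lemma compile_ok st lv : (0 < lv)%N -> wf_stm st ->
  exists K, forall n tau g2 (s : state g2) sg, (0 < n)%N -> loop_env n lv (imem s) ->
    represents n (emem s) sg ->
    runs tau (compile lv st) s (K * n ^ stm_depth st * unit_cost n tau)
      (fun s' => imem s' = imem s /\ represents n (emem s') (run n lv (imem s) st sg)).
Proof.
elim: st lv => [k e|st1 IH1 st2 IH2|st IH] lv lv0.
- by case/andP=> k8 we; apply: compile_tab_ok.
- case/andP=> w1 w2; have [K1 H1] := IH1 lv lv0 w1; have [K2 H2] := IH2 lv lv0 w2.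
  exists (K1 + K2)%N => n tau g2 s sg n0 env rep.
  apply: (@runs_weaken _ _ _ _ (K1 * n ^ stm_depth st1 * unit_cost n tau +
     K2 * n ^ stm_depth st2 * unit_cost n tau)%N _ _ _ _ _ (fun s' h => h)).
    apply: runs_seq (H1 n tau g2 s sg n0 env rep) _ => s1 [ms1 rep1].
    have env1 : loop_env n lv (imem s1) by rewrite ms1.
    apply: runs_weaken (H2 n tau g2 s1 _ n0 env1 rep1) (leqnn _) _ => s2.
    by rewrite ms1.
  rewrite !mulnDl /=; apply: leq_add; rewrite leq_mul2r leq_mul2l leq_pexp2l ?orbT //.
    exact: leq_maxl.
  exact: leq_maxr.
- move=> w; have [K H] := IH lv.+1 (ltn0Sn lv) w; have [K' H'] := runs_loop lv0.
  exists (K + 2 * K')%N => n tau g2 s sg n0 env rep.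
  pose I i (s' : state g2) := represents n (emem s') (iteri i (fun i => run n lv.+1 (upd (imem s) lv i) st) sg).
  apply: runs_weaken (H' n _ g2 tau s (K * n ^ stm_depth st * unit_cost n tau)%N I n0 env _ _ _) _ _ => //.
    move=> i s1 ni ms1 rep1; have env1 : loop_env n lv.+1 (imem s1) by rewrite ms1; apply: loop_env_upd.
    by apply: runs_weaken (H n tau g2 s1 _ n0 env1 rep1) (leqnn _) _ => s2; rewrite ms1.
  rewrite expnS; have q0 : (0 < n ^ stm_depth st)%N by rewrite expn_gt0 n0.
  move: (n ^ stm_depth st)%N (unit_cost n tau) q0 => q u q0.
  have h r : (0 < r)%N -> (K' * u <= K' * r * u)%N by move=> r0; rewrite leq_mul2r leq_pmulr ?orbT.
  apply: (@leq_trans (n * (K * q * u + K' * q * u) + K' * (n * q) * u)%N).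
    by apply: leq_add; rewrite ?leq_mul2l ?leq_add2l ?h ?muln_gt0 ?n0 ?orbT.
  by apply: eq_leq; lia.
Qed.

(** * The program *)

Definition Inv (e : exp) : exp :=
  Times (LiftInv e) (Minus (Plus (Cst true) (Cst true)) (Times e (LiftInv e))).

(* Arrays: 0 = input and output, 1 = interpolation points (on the diagonal), 2 = shifted matrix,
   swept in place, 3 = U, 4 = L, 5 and 6 = partial sums, 7 = accumulator (a constant array). *)
Definition sweep_stm : stm :=
  Then (Tab 3 (IfEq 4 3 (IfLt 5 4 (Cst false) (Cell 2 4 5)) (Cell 3 4 5)))
 (Then (Tab 4 (IfEq 5 3 (IfLt 4 5 (Cst false) (Times (Cell 2 4 5) (Inv (Cell 2 5 5)))) (Cell 4 4 5)))
       (Tab 2 (IfEq 4 3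
          (IfEq 5 3 (Inv (Cell 2 3 3)) (Minus (Cst false) (Times (Cell 2 3 5) (Inv (Cell 2 3 3)))))
          (IfEq 5 3 (Times (Cell 2 4 3) (Inv (Cell 2 3 3)))
             (Minus (Cell 2 4 5) (Times (Times (Cell 2 4 3) (Inv (Cell 2 3 3))) (Cell 2 3 5))))))).

(** The triple sum is tabulated in stages, although array 6 is constant along rows, so that each
    table costs n^3. Summing it inside one entry of a table would cost n^5 per point. *)
Definition collect_stm : stm :=
  Then (Tab 5 (Fold false (let x := Times (Times (Cell 4 3 4) (Cell 3 4 5)) (Cell 2 5 3) in Times x x)))
 (Then (Tab 6 (Fold false (Cell 5 3 5)))
       (Tab 7 (Plus (Cell 7 3 4) (Times (Times (Fold true (Cell 3 5 5))
          (Plus (Cst true) (Fold false (Minus (Cst true) (Cell 6 5 5)))))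
          (Fold true (IfEq 5 2 (Cst true)
             (Times (Cell 1 5 5) (Inv (Minus (Cell 1 5 5) (Cell 1 2 2)))))))))).

Definition point_stm : stm :=
  Then (Tab 2 (Plus (Cell 0 3 4) (IfEq 3 4 (Cell 1 2 2) (Cst false)))) (Then (For sweep_stm) collect_stm).

Definition permanent_stm : stm :=
  Then (For point_stm) (Tab 0 (Plus (Cell 7 2 3) (Fold true (Minus (Cst false) (Cell 1 4 4))))).

Section Run.
Variables (g2 : {poly 'F_2}) (n : nat).
Implicit Types sg : store g2.

Lemma run_sweep_stm m p sg :
  let sg' := run n 4 (upd m 3 p) sweep_stm sg in
  [/\ forall i j, sg' 2 i j = sweep (@einv g2) (sg 2) p i j,
      forall i j, sg' 3 i j = if i == p then if (j < i)%N then 0 else sg 2 i j else sg 3 i j,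
      forall i j, sg' 4 i j = if j == p then if (i < j)%N then 0 else sg 2 i j * einv (sg 2 j j) else sg 4 i j &
      forall k i j, k \notin [:: 2; 3; 4] -> sg' k i j = sg k i j].
Proof.
split=> [i j|i j|i j|k i j]; rewrite /= /upd //=.
by rewrite !inE !negb_or => /and3P[/negPf-> /negPf-> /negPf->].
Qed.

(** Row [i] of array 3 and column [i] of array 4 are written at sweep [i] and kept afterwards. *)
Lemma run_sweeps m p sg B : (forall i j, sg 2 i j = B i j) ->
  let sg' := iteri p (fun i => run n 4 (upd m 3 i) sweep_stm) sg in
  [/\ forall i j, sg' 2 i j = sweeps (@einv g2) B p i j,
      forall i j, (i < p)%N -> sg' 3 i j = sweepU (@einv g2) B i j,
      forall i j, (j < p)%N -> sg' 4 i j = sweepL (@einv g2) B i j &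
      forall k i j, k \notin [:: 2; 3; 4] -> sg' k i j = sg k i j].
Proof.
move=> sgB; elim: p => [|p IH]; first by split.
pose sg' := iteri p (fun i => run n 4 (upd m 3 i) sweep_stm) sg.
have {IH} [IH2 IH3 IH4 IHk] := IH; rewrite -/sg' in IH2 IH3 IH4 IHk.
have [H2 H3 H4 Hk] := run_sweep_stm m p sg'.
move=> sg''; have -> : sg'' = run n 4 (upd m 3 p) sweep_stm sg' by [].
split=> [i j|i j|i j|k i j].
- by rewrite H2 /sweep !IH2.
- rewrite ltnS leq_eqVlt H3 => /predU1P[->|ip]; first by rewrite eqxx IH2.
  by rewrite ltn_eqF // IH3.
- rewrite ltnS leq_eqVlt H4 => /predU1P[->|ip]; first by rewrite eqxx !IH2.
  by rewrite ltn_eqF // IH4.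
- by move=> kn; rewrite Hk // IHk.
Qed.

Lemma run_collect_stm m t sg :
  let sg' := run n 3 (upd m 2 t) collect_stm sg in
  (forall i j, sg' 7 i j = sg 7 i j + (\prod_(p < n) sg 3 p p) *
     (1 + \sum_(i < n) (1 - \sum_(j < n) \sum_(k < n) (sg 4 i j * sg 3 j k * sg 2 k i) ^+ 2)) *
     \prod_(s < n) (if s == t :> nat then 1 else sg 1 s s * einv (sg 1 s s - sg 1 t t))) /\
  forall k i j, k \notin [:: 5; 6; 7] -> sg' k i j = sg k i j.
Proof.
split=> [i j|k i j]; rewrite /= /upd //=.
by rewrite !inE !negb_or => /and3P[/negPf-> /negPf-> /negPf->].
Qed.

Lemma run_point_stm m t sg :
  let sg' := run n 3 (upd m 2 t) point_stm sg in
  (forall i j, sg' 7 i j = sg 7 i j + point_term n (sg 0) (fun s => sg 1 s s) t) /\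
  forall k i j, (k < 2)%N -> sg' k i j = sg k i j.
Proof.
pose sg1 := run n 3 (upd m 2 t) (Tab 2 (Plus (Cell 0 3 4) (IfEq 3 4 (Cell 1 2 2) (Cst false)))) sg.
have sg1A i j : sg1 2 i j = shifted (sg 0) (sg 1 t t) i j by rewrite /sg1 /= /upd.
have sg1k k i j : k != 2 -> sg1 k i j = sg k i j by move=> /negPf k2; rewrite /sg1 /= k2.
pose sg2 := iteri n (fun p => run n 4 (upd (upd m 2 t) 3 p) sweep_stm) sg1.
have [H2 H3 H4 Hk] := run_sweeps (upd m 2 t) n sg1A.
rewrite -/sg2 in H2 H3 H4 Hk.
have [C7 Ck] := run_collect_stm m t sg2.
move=> sg'; have -> : sg' = run n 3 (upd m 2 t) collect_stm sg2 by [].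
split=> [i j|k i j k2]; last first.
  by rewrite Ck ?Hk ?sg1k //; case: k k2 => [|[|]].
rewrite C7 Hk // sg1k // /point_term; congr (_ + _ * (1 + _) * _).
- by apply: eq_bigr => p _; rewrite H3.
- apply: eq_bigr => a _; congr (_ - _); apply: eq_bigr => b _; apply: eq_bigr => c _.
  by rewrite H2 H3 // H4.
- by apply: eq_bigr => s _; rewrite !Hk // !sg1k.
Qed.

Lemma run_permanent_stm m sg A y : (0 < n)%N ->
  (forall i j, sg 0 i j = A i j) -> (forall t, sg 1 t t = y t) -> (forall i j, sg 7 i j = 0) ->
  run n 2 m permanent_stm sg 0 0 0 = \sum_(t < n) point_term n A y t + \prod_(t < n) (0 - y t).
Proof.
move=> n0 sgA sgy sg0.
have inv p : let sg' := iteri p (fun t => run n 3 (upd m 2 t) point_stm) sg in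
    (forall i j, sg' 7 i j = \sum_(t < p) point_term n A y t) /\
    forall k i j, (k < 2)%N -> sg' k i j = sg k i j.
  elim: p => [|p IH]; first by split=> // i j; rewrite big_ord0.
  pose sg' := iteri p (fun t => run n 3 (upd m 2 t) point_stm) sg.
  have {IH} [IH7 IHk] := IH; rewrite -/sg' in IH7 IHk.
  have [H7 Hk] := run_point_stm m p sg'.
  move=> sg''; have -> : sg'' = run n 3 (upd m 2 p) point_stm sg' by [].
  split=> [i j|k i j k2]; last by rewrite Hk // IHk.
  rewrite H7 IH7 big_ord_recr /=; congr (_ + _).
  have -> : sg' 0 = A by apply/funext => a; apply/funext => b; rewrite IHk.
  by have -> : (fun s => sg' 1 s s) = y by apply/funext => a; rewrite IHk.
have [H7 Hk] := inv n.
pose sg' := iteri n (fun t => run n 3 (upd m 2 t) point_stm) sg.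
have -> : run n 2 m permanent_stm sg = run n 2 m
  (Tab 0 (Plus (Cell 7 2 3) (Fold true (Minus (Cst false) (Cell 1 4 4))))) sg' by [].
rewrite -/sg' in H7 Hk; rewrite /= /upd /= H7; congr (_ + _); apply: eq_bigr => t _.
by rewrite Hk // sgy.
Qed.
End Run.

(** * The complete program and its correctness *)

Definition draw_points : cmd :=
  loop 2 (CSeq (CRand (ICst 0)) (CInstr (FLift (cell 1 2 2) (ICst 0)))).

(** Cell 1 initially holds [d], which may exceed [n]; clearing it establishes [loop_env]. *)
Definition permanent_program : cmd :=
  CSeq (CInstr (ISet (ICst 1) (ICst 0))) (CSeq draw_points (compile 2 permanent_stm)).

Definition entries (R : nzRingType) n (M : 'M[R]_n) : seq R := [seq M i j | i <- enum 'I_n, j <- enum 'I_n].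

Lemma size_entries (R : nzRingType) n (M : 'M[R]_n) : size (entries M) = (n * n)%N.
Proof. by rewrite size_allpairs size_enum_ord. Qed.

Lemma nth_entries (R : nzRingType) n (M : 'M[R]_n) (i j : 'I_n) :
  nth 0 (entries M) (i * n + j) = M i j.
Proof.
have aux (s : seq 'I_n) (k : nat) x0 : (k < size s)%N ->
    nth 0 [seq M i' j' | i' <- s, j' <- enum 'I_n] (k * n + j) = M (nth x0 s k) j.
  elim: s k => [//|x s IH] [|k] ks; rewrite allpairs_cons nth_cat size_map size_enum_ord.
    by rewrite mul0n add0n ltn_ord (nth_map j) ?size_enum_ord // nth_ord_enum.
  by rewrite mulSn -addnA ltnNge leq_addr /= addKn IH.
by rewrite (aux _ _ i) ?size_enum_ord // nth_ord_enum.
Qed.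

Lemma draw_points_ok : exists K, forall n tau g2 (s : state g2) (A : nat -> nat -> E4d g2), (0 < n)%N ->
  loop_env n 2 (imem s) -> size (tape s) = n ->
  represents n (emem s) (fun k i j => if k == 0 then A i j else 0) ->
  runs tau draw_points s (K * n ^ 1 * unit_cost n tau) (fun s' => imem s' = imem s /\
    represents n (emem s') (fun k i j => if k == 0 then A i j else
      if (k == 1) && (i == j) then liftE (nth 0 (tape s) i) else 0)).
Proof.
(* A random draw costs the same as this constant assignment. *)
have [K1 H1] := step_cost_bound (FConst (ICst 0) true).
have [K2 H2] := step_cost_bound (FLift (cell 1 2 2) (ICst 0)).
have [K3 H3] := runs_loop (isT : (0 < 2)%N).
exists (K1 + K2 + 2 * K3)%N => n tau g2 s A n0 env sr rep; set u := unit_cost n tau.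
pose I i (s' : state g2) := tape s' = drop i (tape s) /\
  represents n (emem s') (fun k a b => if k == 0 then A a b else
      if [&& k == 1, a == b & (a < i)%N] then liftE (nth 0 (tape s) a) else 0).
apply: (@runs_weaken _ _ _ _ (n * (K1 * u + K2 * u + K3 * u) + K3 * u)%N _ (fun s' => imem s' = imem s /\ I n s')).
- apply: (H3 n _ g2 tau s _ I n0 env) => //.
    move=> i s1 ni ms1 [t1 rep1].
    have env1 : loop_env n 3 (imem s1) by rewrite ms1; apply: loop_env_upd.
    have le1 c : (imem s1 c <= n)%N by apply: loop_env_le env1.
    have te : tape s1 = nth 0 (tape s) i :: drop i.+1 (tape s) by rewrite t1 (drop_nth 0) ?sr.
    pose s2 := set_tape (set_fmem s1 (upd (fmem s1) 0 (nth 0 (tape s) i))) (drop i.+1 (tape s)).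
    apply: (runs_seq (Q1 := fun s' => s' = s2)).
      exists (icost (imem s1) (ICst 0) + tau + 1)%N, s2; split=> //; first exact: ExRand.
      exact: (H1 n tau g2 s1 le1).
    move=> _ ->; apply: runs_instr; first exact: H2.
    split=> //; split=> // k a b k8 na nb.
    have u2 : upd (imem s) 2 i 2 = i by rewrite updE eqxx.
    rewrite /= (ival_cell _ _ _ env1) ms1 u2 updE addr_inj //.
    case: (eqVneq k 1) => [->|k1] /=; last first.
      by rewrite rep1 // (negPf k1).
    case: (eqVneq a i) => [->|ai] /=.
      rewrite (eq_sym b); case: (i =P b) => [_|/eqP/negPf ib] /=; first by rewrite ltnSn updE eqxx.
      by rewrite rep1 //= ib.
    by rewrite rep1 //= ltnS (leq_eqVlt a) (negPf ai).
  split; first by rewrite drop0.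
  by move=> k a b k8 na nb; rewrite rep // andbF andbF.
- by rewrite expn1; clearbody u; clear -n0; nia.
- move=> s' [ms' [_ rep']]; split=> // k a b k8 na nb.
  by rewrite rep' // na andbT.
Qed.

(** No assumption is made on the drawn values: time bound and output formula hold for all tapes of
    length [n], and only the equality of the output with the permanent needs good points. The
    exponent 4 is the depth of [permanent_stm]. *)
Lemma permanent_program_ok : exists K, forall n d tau g2 (M : 'M[E4d g2]_n) (r : seq (F2d g2)),
  (0 < n)%N -> size r = n ->
  let A i j := nth 0 (entries M) (i * n + j) in
  let y t := liftE (nth 0 r t) in
  runs tau permanent_program (init d M r) (K * n ^ 4 * unit_cost n tau)
    (fun s' => emem s' 0 = \sum_(t < n) point_term n A y t + \prod_(t < n) (0 - y t)).
Proof.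
have [K1 H1] := draw_points_ok.
have [K2 H2] := @compile_ok permanent_stm 2 isT isT.
exists (3 + K1 + K2)%N => n d tau g2 M r n0 sr A y; set u := unit_cost n tau.
(* Clearing cell 1 costs 3: two constants of bit length 1, plus 1. *)
apply: (@runs_weaken _ _ _ _ (3 * u + (K1 * n ^ 1 * u + K2 * n ^ 4 * u))%N _ _ _ _ _ (fun s' h => h)).
  pose s1 := step (init d M r) (ISet (ICst 1) (ICst 0)).
  apply: (runs_seq (Q1 := fun s' => s' = s1)).
    apply: runs_instr => //=; rewrite /bits trunc_log0 trunc_log1 /u /unit_cost; lia.
  move=> _ ->.
  have env1 : loop_env n 2 (imem s1).
    by split=> [//|[|[|a]]|[|[|a]]].
  have rep1 : represents n (emem s1) (fun k i j => if k == 0 then A i j else 0).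
    move=> k i j _ ni nj; rewrite /s1 /= /addr; case: k => [|k] //=.
    by rewrite nth_default // -/(entries M) size_entries mulSn -addnA leq_addr.
  apply: runs_seq (H1 n tau g2 s1 A n0 env1 sr rep1) _ => s2 [ms2 rep2].
  have env2 : loop_env n 2 (imem s2) by rewrite ms2.
  apply: runs_weaken (H2 n tau g2 s2 _ n0 env2 rep2) (leqnn _) _ => s3 [_ rep3].
  have := rep3 0 0 0 isT n0 n0; rewrite /addr => ->.
  apply: run_permanent_stm => // t; by rewrite /= eqxx.
have p1 : (0 < n ^ 4)%N by rewrite expn_gt0 n0.
have p2 : (n ^ 1 <= n ^ 4)%N by apply: leq_pexp2l.
have le1 : (3 * u <= 3 * n ^ 4 * u)%N by rewrite leq_mul2r leq_pmulr ?orbT.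
have le2 : (K1 * n ^ 1 * u <= K1 * n ^ 4 * u)%N by rewrite leq_mul2r leq_mul2l p2 !orbT.
have -> : ((3 + K1 + K2) * n ^ 4 * u = 3 * n ^ 4 * u + (K1 * n ^ 4 * u + K2 * n ^ 4 * u))%N.
  by clearbody u; ring.
by apply: leq_add => //; apply: leq_add.
Qed.

Lemma permanent_program_correct n d tau g2 (M : 'M[E4d g2]_n) (r : seq (F2d g2)) :
  (0 < n)%N -> (0 < d)%N -> size g2 = d.+1 -> irreducible_poly g2 ->
  let A i j := nth 0 (entries M) (i * n + j) in
  size r = n -> uniq r -> all (good_point n A) r ->
  outputs tau permanent_program d M r (permanent M).
Proof.
move=> n0 d0 sg irr A sr ur gr; have [K H] := permanent_program_ok.
have [t [s [ex _ e]]] := H n d tau g2 M r n0 sr; exists t, s; split=> //; rewrite e.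
have EM : block n A = M by apply/matrixP => i j; rewrite mxE /A nth_entries.
have gp k : (k < n)%N -> good_point n A (nth 0 r k).
  by move=> kn; apply: (allP gr); rewrite mem_nth ?sr.
have inj k l : (k < n)%N -> (l < n)%N -> k != l -> nth 0 r k != nth 0 r l.
  by move=> kn ln kl; rewrite nth_uniq ?sr.
have PM := permanent_good_points d0 sg irr gp inj; rewrite EM in PM.
exact: esym PM.
Qed.

(** * Lower bound on omega *)

Section StraightLine.
Variable K : fieldType.
Implicit Types (v : seq K) (ops : seq slp_instr).

Lemma slp_run_cat ops ops' v : slp_run (ops ++ ops') v = slp_run ops' (slp_run ops v).
Proof. by rewrite /slp_run foldl_cat. Qed.

Lemma size_slp_run ops v : size (slp_run ops v) = (size v + size ops)%N.
Proof.
elim: ops v => [|o ops IH] v /=; first by rewrite addn0.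
by rewrite IH size_rcons addSnnS.
Qed.

Lemma nth_slp_run ops v a : (a < size v)%N -> (slp_run ops v)`_a = v`_a.
Proof.
elim: ops v => [//|o ops IH] v lt /=.
by rewrite IH ?nth_rcons ?lt // size_rcons ltnS (ltnW lt).
Qed.
End StraightLine.

(** Testing over ['F_2] shows that the output positions are pairwise distinct and all belong to
    computed values, so there are at least n^2 instructions. *)
Lemma slp_mulmx_size n ops out : (0 < n)%N -> @slp_mulmx n ops out -> (n * n <= size ops)%N.
Proof.
move=> n0 H; have c2 : 2%N \in [pchar 'F_2] by apply: pchar_Fp.
have {}H := H 'F_2 c2.
have se (A : 'M['F_2]_n) : size (mx_entries A) = (n * n)%N by apply: size_entries.
(* No output sits at an input position: with one factor all ones and the other 0, the position could
   hold a 1 while the product is 0. *)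
have ge i j : (n * n + n * n <= out i j)%N.
  rewrite leqNgt; apply/negP => lt; case: (ltnP (out i j) (n * n)) => lt1.
    have := H (const_mx 1) 0 i j; rewrite mulmx0 mxE nth_slp_run ?size_cat ?se //.
    rewrite nth_cat se lt1 => /eqP; apply/negP.
    have : (mx_entries (const_mx 1 : 'M['F_2]_n))`_(out i j) \in mx_entries (const_mx 1 : 'M['F_2]_n).
      by rewrite mem_nth ?se.
    by case/allpairsP => -[a b] /= [_ _ ->]; rewrite mxE.
  have := H 0 (const_mx 1) i j; rewrite mul0mx mxE nth_slp_run ?size_cat ?se //.
  rewrite nth_cat se ltnNge lt1 /= => /eqP; apply/negP.
  have : (mx_entries (const_mx 1 : 'M['F_2]_n))`_(out i j - n * n) \in mx_entries (const_mx 1 : 'M['F_2]_n).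
    by rewrite mem_nth ?se // ltn_subLR.
  by case/allpairsP => -[a b] /= [_ _ ->]; rewrite mxE.
pose k0 := Ordinal n0.
have Hd i j i' j' : (slp_run ops (mx_entries (delta_mx i k0 : 'M['F_2]_n) ++ mx_entries (delta_mx k0 j)))`_(out i' j') =
    ((i' == i) && (j' == j))%:R by rewrite H mul_delta_mx mxE.
(* A position past the end reads the default 0, but this product has a 1 there. *)
have lt i j : (out i j - (n * n + n * n) < size ops)%N.
  rewrite ltn_subLR ?ge // ltnNge; apply/negP => le.
  have := Hd i j i j; rewrite nth_default ?size_slp_run ?size_cat ?se // !eqxx.
  by move/eqP.
pose f (p : 'I_n * 'I_n) := Ordinal (lt p.1 p.2).
have inj : injective f.
  move=> [i j] [i' j'] /(congr1 val) /= E.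
  have {}E : out i j = out i' j' by rewrite -(subnK (ge i j)) E subnK.
  have := Hd i j i j; rewrite E Hd !eqxx.
  by case: eqP => [->|]; case: eqP => [->|] //= _ _ /eqP.
by have := leq_card f inj; rewrite card_prod !card_ord.
Qed.

(** One instruction starts the sum at 0, then each pair takes a product and an addition; the running
    sum is always the last value. *)
Lemma slp_dot N (l : seq (nat * nat)) : all (fun p => (p.1 < N) && (p.2 < N))%N l ->
  exists2 ops, size ops = (2 * size l).+1 & forall (K : fieldType) (v : seq K), size v = N ->
    (slp_run ops v)`_(N + 2 * size l) = \sum_(p <- l) v`_p.1 * v`_p.2.
Proof.
elim: l => [|p l IH] /=.
  exists [:: SConst false] => // K v sv; rewrite big_nil /= muln0 addn0.
  by rewrite nth_rcons sv ltnn eqxx.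
case/andP=> /andP[p1 p2] /IH [ops sops H].
exists (ops ++ [:: SMul p.1 p.2; SAdd (N + 2 * size l) (N + 2 * size l).+1]).
  by rewrite size_cat sops /=; lia.
move=> K v sv; rewrite slp_run_cat big_cons /=.
set w := slp_run ops v; have sw : size w = (N + 2 * size l).+1 by rewrite size_slp_run sv sops addnS.
have -> : (N + 2 * (size l).+1 = (N + 2 * size l).+2)%N by lia.
rewrite nth_rcons size_rcons sw ltnn eqxx !nth_rcons sw ltnSn ltnn eqxx H //.
by rewrite !nth_slp_run ?sv // addrC.
Qed.

Lemma slp_dots N (L : seq (seq (nat * nat))) : all (all (fun p => (p.1 < N) && (p.2 < N))%N) L ->
  exists ops (out : nat -> nat), size ops = sumn [seq (2 * size l).+1 | l <- L] /\
    forall (K : fieldType) (v : seq K) k, size v = N -> (k < size L)%N ->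
    (slp_run ops v)`_(out k) = \sum_(p <- nth [::] L k) v`_p.1 * v`_p.2 /\
    (out k < N + size ops)%N.
Proof.
elim/last_ind: L => [|L l IH]; first by exists [::], id; split.
rewrite all_rcons => /andP[al /IH [ops [out [sops H]]]].
have al' : all (fun p => (p.1 < N + size ops) && (p.2 < N + size ops))%N l.
  by apply: sub_all al => p /andP[p1 p2]; rewrite !ltn_addr.
have [ops' sops' H'] := slp_dot al'.
exists (ops ++ ops'), (fun k => if (k < size L)%N then out k else (N + size ops + 2 * size l)%N).
split; first by rewrite size_cat sops sops' map_rcons -cats1 sumn_cat /= addn0.
move=> K v k sv; rewrite size_rcons ltnS leq_eqVlt slp_run_cat nth_rcons size_cat.
have sw : size (slp_run ops v) = (N + size ops)%N by rewrite size_slp_run sv.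
case/predU1P=> [->|kL].
  rewrite ltnn eqxx H' // sops' addnA addnS ltnS leqnn; split=> //.
  apply: eq_big_seq => p pl; have /andP[p1 p2] := allP al _ pl.
  by rewrite !nth_slp_run ?sv.
rewrite kL; have [E lt] := H K v k sv kL; rewrite nth_slp_run ?sw //; split=> //.
by rewrite addnA ltn_addr.
Qed.

(** Shows that the set of exponents defining [omega] contains 3, hence is nonempty, as bounding its
    infimum from below requires. *)
Lemma slp_mulmx_schoolbook n : (0 < n)%N -> exists ops out,
  @slp_mulmx n ops out /\ (size ops <= 3 * n ^ 3)%N.
Proof.
move=> n0; pose N := (n * n + n * n)%N.
pose L := [seq [seq (i * n + k, n * n + (k * n + j))%N | k <- iota 0 n] | i <- iota 0 n, j <- iota 0 n].
have lt a b : (a < n)%N -> (b < n)%N -> (a * n + b < n * n)%N.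
  by move=> an bn; apply: (@leq_trans (a.+1 * n)); [rewrite mulSn; lia|rewrite leq_mul2r an orbT].
have aL : all (all (fun p => (p.1 < N) && (p.2 < N))%N) L.
  apply/allP => l /allpairsP [[i j] /= [iI jI ->]]; apply/allP => p /mapP [k kI ->] /=.
  rewrite !mem_iota !add0n /= in iI jI kI.
  by rewrite /N ltn_add2l (ltn_addr _ (lt i k _ _)) // lt.
have [ops [out [sops H]]] := slp_dots aL.
have sL : size L = (n * n)%N by rewrite size_allpairs size_iota.
have nthL (i j : 'I_n) : nth [::] L (i * n + j) = [seq (i * n + k, n * n + (k * n + j))%N | k <- iota 0 n].
  have aux (s : seq nat) (m : nat) : (m < size s)%N -> nth [::]
      [seq [seq (i' * n + k, n * n + (k * n + j'))%N | k <- iota 0 n] | i' <- s, j' <- iota 0 n] (m * n + j) =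
      [seq (nth 0 s m * n + k, n * n + (k * n + j))%N | k <- iota 0 n].
    elim: s m => [//|x s IH] [|m] ms; rewrite allpairs_cons nth_cat size_map size_iota.
      by rewrite mul0n add0n ltn_ord (nth_map 0) ?size_iota // nth_iota.
    by rewrite mulSn -addnA ltnNge leq_addr /= addKn IH.
  by rewrite (aux _ i) ?size_iota // nth_iota.
exists ops, (fun i j => out (i * n + j)%N); rewrite sops; split.
  move=> K _ A B i j; have sv : size (mx_entries A ++ mx_entries B) = N.
    by rewrite size_cat !size_entries.
  have [|-> _] := H K _ (i * n + j)%N sv; first by rewrite sL lt.
  rewrite nthL // big_map mxE (_ : iota 0 n = index_iota 0 n); last by rewrite /index_iota subn0.
  rewrite big_mkord; apply: eq_bigr => k _ /=.
  rewrite !nth_cat !size_entries lt // ltnNge leq_addr /= addKn.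
  by rewrite !(nth_entries _ _ _).
have -> : sumn [seq (2 * size l).+1 | l <- L] = (n * n * (2 * n).+1)%N.
  have : all (fun l => size l == n) L.
    by apply/allP => l /allpairsP [[i j] /= [_ _ ->]]; rewrite size_map size_iota.
  rewrite -sL; elim: (L) => [//|l s IH] /= /andP[/eqP-> /IH ->]; lia.
rewrite !expnS expn0 muln1; nia.
Qed.

Section Omega.
Variable R : realType.

Lemma omega_ge2 : 2 <= omega R.
Proof.
apply: lb_le_inf.
  exists 3; exists 3 => n n0; have [ops [out [H le]]] := slp_mulmx_schoolbook n0.
  exists ops, out; split=> //.
  rewrite powR_mulrn // -natrX -natrM ler_nat //.
move=> e [C HC]; rewrite leNgt; apply/negP => e2.
have d0 : 0 < 2 - e by rewrite subr_gt0.
(* For [e < 2], the n^2 lower bound forces n^(2-e) <= C. This [b] is where that power reaches |C| +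
   1, and [n] is an integer beyond it. *)
pose b := (`|C| + 1) `^ (2 - e)^-1; pose n := (Num.truncn b).+1.
have bn : b < n%:R by apply: truncnS_gt.
have [ops [out [H le]]] := HC n (ltn0Sn _).
have n2 : n%:R ^+ 2 <= C * n%:R `^ e.
  by apply: le_trans le; rewrite -natrX ler_nat -mulnn; apply: slp_mulmx_size H.
have : n%:R `^ (2 - e) <= C.
  have ne : 0 < (n%:R : R) `^ e by rewrite powR_gt0 // ltr0n.
  rewrite -(ler_pM2r ne) -powRD; last by rewrite pnatr_eq0 /n implybT.
  by rewrite subrK powR_mulrn ?ler0n.
suff lt : C < n%:R `^ (2 - e) by move=> le'; have := lt_le_trans lt le'; rewrite ltxx.
apply: (@lt_le_trans _ _ (`|C| + 1)).
  by apply: le_lt_trans (ler_norm C) _; rewrite ltrDl.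
have c0 : 0 <= `|C| + 1 by rewrite addr_ge0.
have {1}-> : `|C| + 1 = b `^ (2 - e) by rewrite -powRrM mulVf ?powRr1 // gt_eqF.
by apply: ge0_ler_powR; rewrite ?nnegrE ?powR_ge0 ?ler0n // ltW.
Qed.
End Omega.

(** * Success probability and running time *)

Lemma bernoulli_inequality (R : realDomainType) (x : R) n : 0 <= x <= 1 ->
  1 - n%:R * x <= (1 - x) ^+ n.
Proof.
case/andP=> x0 x1; elim: n => [|n IH]; first by rewrite mul0r subr0 expr0.
rewrite exprS; apply: (@le_trans _ _ ((1 - x) * (1 - n%:R * x))); last by rewrite ler_wpM2l // subr_ge0.
have h : 0 <= n%:R * x * x by rewrite !mulr_ge0 ?ler0n.
rewrite -natr1; lra.
Qed.

Lemma ffact_ge_exp a n : ((a - n) ^ n <= a ^_ n)%N.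
Proof.
rewrite ffact_prod -[X in (_ ^ X <= _)%N](card_ord n) -prod_nat_const; apply: leq_prod => i _.
by rewrite leq_sub2l // ltnW.
Qed.

(** With N field elements, b of them bad, the good tuples without repetition number at least (N - b
    - n)^n. Bernoulli's inequality leaves a failure probability of at most n(b + n)/N, and b <=
    n(n+1)/2 gives b + n <= 2n^2. *)
Lemma good_tuples_prob (R : realType) (g2 : {poly 'F_2}) (d n : nat) (A : nat -> nat -> E4d g2) :
  (0 < n)%N -> (0 < d)%N -> size g2 = d.+1 -> irreducible_poly g2 ->
  1 - 2 ^ (1 - d%:Z) * n%:R ^+ 3 <=
  #|[set r : n.-tuple (F2d g2) | all (good_point n A) r & uniq r]|%:R / #|{: n.-tuple (F2d g2)}|%:R :> R.
Proof.
move=> n0 d0 sg irr; rewrite card_tuple (card_F2d d0 sg) card_uniq_tuples.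
pose b := #|[set x | ~~ good_point n A x]|; set N := (2 ^ d)%N.
have cb : (2 * b <= n * n.+1)%N by exact: (card_bad_points d0 sg irr n A).
have cG : #|good_point n A| = (N - b)%N.
  have bE : b = #|[predC good_point n A]| by apply: eq_card => x; rewrite !inE.
  by rewrite /N -(card_F2d d0 sg) bE -(cardC (good_point n A)) addnK.
rewrite cG; have N0 : 0 < N%:R :> R by rewrite ltr0n expn_gt0.
have -> : 2 ^ (1 - d%:Z) = 2 / N%:R :> R by rewrite expfzDr // expr1z -exprnN natrX.
have cn : ((b + n)%N <= 2 * n ^ 2)%N by rewrite -mulnn; nia.
have cR : n%:R * (b + n)%:R <= 2 * n%:R ^+ 3 :> R.
  by rewrite -natrM -natrX -natrM ler_nat expnS mulnCA leq_mul2l cn orbT.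
(* If b + n exceeds N, the claimed bound is not positive. *)
case: (leqP (b + n)%N N) => le; last first.
  apply: (@le_trans _ _ 0); last by rewrite divr_ge0 ?ler0n.
  rewrite subr_le0 mulrAC ler_pdivlMr // mul1r; apply: le_trans cR.
  by rewrite -natrM ler_nat (leq_trans (ltnW le)) // leq_pmull.
pose x : R := (b + n)%:R / N%:R.
have x01 : 0 <= x <= 1 by rewrite divr_ge0 ?ler0n //= ler_pdivrMr // mul1r ler_nat.
apply: (@le_trans _ _ ((1 - x) ^+ n)).
  apply: le_trans (bernoulli_inequality n x01); rewrite lerD2l lerN2 /x mulrA [2 / _ * _]mulrAC.
  by rewrite ler_pM2r ?invr_gt0.
have -> : 1 - x = (N - b - n)%:R / N%:R.
  by rewrite -subnDA natrB // mulrBl divff // gt_eqF.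
by rewrite expr_div_n -!natrX ler_pM2r ?invr_gt0 ?ltr0n ?expn_gt0 // ler_nat ffact_ge_exp.
Qed.

(** [omega_ge2] turns n^4 into the stated power. Address arithmetic contributes two logarithmic
    factors and [T] contributes [k]; both are at most the power [k.+2]. *)
Lemma time_softO (R : realType) (T : nat -> nat) (K k : nat) (C : R) :
  (forall d, (0 < d)%N -> softO_bound C k d%:R (T d)%:R) ->
  exists (C' : R) (k' : nat), forall n d, (0 < n)%N -> (0 < d)%N ->
    softO_bound C' k' (n%:R `^ (2 + omega R) * d%:R) (K * n ^ 4 * unit_cost n (T d))%:R.
Proof.
move=> TO; pose a : R := ln 2.
have a0 : 0 < a by rewrite ln_gt0 // ltr1n.
(* In the 5, 4 comes from the squared bit length and 1 from the additive constant of [unit_cost];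
   powers of [a] convert natural logarithms to base 2. *)
exists (K%:R * (5 + `|C| * a ^+ k) / a ^+ k.+2), k.+2 => n d n0 d0.
rewrite /softO_bound; set f := _ `^ _ * _; set l := ln (f + 2).
have n1 : 1 <= n%:R :> R by rewrite ler1n.
have d1 : 1 <= d%:R :> R by rewrite ler1n.
have n4 : n%:R ^+ 4 <= n%:R `^ (2 + omega R).
  rewrite -powR_mulrn ?ler0n //; apply: ler_powR => //.
  by have := omega_ge2 R; lra.
have fge : n%:R ^+ 4 * d%:R <= f by rewrite ler_pM2r ?ltr0n.
have n41 : 1 <= n%:R ^+ 4 :> R by rewrite exprn_ege1.
have fd : d%:R <= f by apply: le_trans fge; rewrite ler_peMl ?ler0n.
have fn : n%:R <= f.
  apply: le_trans fge; apply: (@le_trans _ _ (n%:R ^+ 4)); first by rewrite exprS ler_peMr ?ler0n ?exprn_ege1.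
  by rewrite ler_peMr // (le_trans _ n41).
have f1 : 1 <= f by apply: le_trans fd.
(* The base-2 logarithm of [f + 2]. It is at least 1, so its higher powers dominate the lower
   ones. *)
pose q := l / a.
have lE : l = q * a by rewrite /q divfK // gt_eqF.
have q1 : 1 <= q.
  by rewrite ler_pdivlMr // mul1r ler_ln ?posrE //; lra.
have q0 : 0 <= q by lra.
have tlq : (trunc_log 2 n.+2)%:R <= q.
  rewrite ler_pdivlMr //; apply: (@le_trans _ _ (ln (2 ^+ trunc_log 2 n.+2))).
    by rewrite lnXn // mulr_natl.
  rewrite ler_ln ?posrE ?exprn_gt0 //; last by lra.
  apply: (@le_trans _ _ (n.+2)%:R); first by rewrite -natrX ler_nat trunc_logP.
  by rewrite -addn2 natrD lerD2r.
have bq : (bits n.+2)%:R <= 2 * q by rewrite /bits -natr1; lra.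
have b2 : ((bits n.+2) ^ 2)%:R <= 4 * q ^+ 2.
  have -> : 4 * q ^+ 2 = (2 * q) ^+ 2 by ring.
  by rewrite natrX lerXn2r ?nnegrE ?ler0n // mulr_ge0.
have Tq : (T d)%:R <= `|C| * d%:R * (q * a) ^+ k.
  apply: le_trans (TO d d0) _; rewrite -lE; apply: (@le_trans _ _ (`|C| * d%:R * ln (d%:R + 2) ^+ k)).
    have ln0 : 0 <= ln (d%:R + 2 : R) ^+ k by rewrite exprn_ge0 // ln_ge0 //; lra.
    by rewrite ler_wpM2r // ler_wpM2r ?ler0n // ler_norm.
  rewrite ler_wpM2l ?mulr_ge0 ?ler0n //; apply: lerXn2r; rewrite ?nnegrE ?ln_ge0 //; try lra.
  by rewrite ler_ln ?posrE //; lra.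
have qk : q ^+ k <= q ^+ k.+2 by apply: ler_weXn2l => //; rewrite ltnW.
have q2 : q ^+ 2 <= q ^+ k.+2 by apply: ler_weXn2l.
have q1k : 1 <= q ^+ k.+2 by rewrite exprn_ege1.
have U : (unit_cost n (T d))%:R <= (5 + `|C| * a ^+ k) * d%:R * q ^+ k.+2.
  rewrite /unit_cost !natrD.
  have h1 : 4 * q ^+ 2 <= 4 * d%:R * q ^+ k.+2.
    rewrite -mulrA ler_pM2l //; apply: le_trans q2 _; rewrite ler_peMl //; lra.
  have h2 : `|C| * d%:R * (q * a) ^+ k <= `|C| * a ^+ k * d%:R * q ^+ k.+2.
    rewrite exprMn (_ : _ * d%:R * (_ * _) = `|C| * a ^+ k * d%:R * q ^+ k); last by ring.
    by rewrite ler_wpM2l // !mulr_ge0 ?ler0n // exprn_ge0 // ltW.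
  have h3 : 1 <= d%:R * q ^+ k.+2 by rewrite mulr_ege1.
  apply: (@le_trans _ _ (4 * d%:R * q ^+ k.+2 + `|C| * a ^+ k * d%:R * q ^+ k.+2 + d%:R * q ^+ k.+2)).
    by rewrite lerD // lerD // ?(le_trans b2) // (le_trans Tq).
  by rewrite le_eqVlt; apply/orP; left; apply/eqP; ring.
rewrite natrM [(K * n ^ 4)%:R]natrM natrX.
have -> : K%:R * (5 + `|C| * a ^+ k) / a ^+ k.+2 * f * l ^+ k.+2 =
    K%:R * (5 + `|C| * a ^+ k) * f * q ^+ k.+2.
  by rewrite /q expr_div_n; ring.
apply: (@le_trans _ _ (K%:R * n%:R ^+ 4 * ((5 + `|C| * a ^+ k) * d%:R * q ^+ k.+2))).
  by rewrite ler_wpM2l // mulr_ge0 ?ler0n ?exprn_ge0.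
rewrite (_ : K%:R * _ * _ = K%:R * (5 + `|C| * a ^+ k) * (n%:R ^+ 4 * d%:R) * q ^+ k.+2); last by ring.
have c5 : 0 <= 5 + `|C| * a ^+ k by rewrite addr_ge0 // mulr_ge0 // exprn_ge0 // ltW.
rewrite ler_wpM2r ?exprn_ge0 // ler_wpM2l // mulr_ge0 ?ler0n //.
Qed.

Theorem lemma9 (R : realType) :
  exists p : cmd,
  forall T : nat -> nat,
    (exists (C : R) (k : nat), forall d : nat, (0 < d)%N ->
        softO_bound C k d%:R (T d)%:R) ->
  exists (C : R) (k : nat),
  forall (n d : nat) (g2 : {poly 'F_2}) (M : 'M[E4d g2]_n),
    (0 < n)%N -> (0 < d)%N -> size g2 = d.+1 -> irreducible_poly g2 ->
  exists L t : nat,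
    [/\ forall r : L.-tuple (F2d g2), halts_within (T d) p d M r t,
        softO_bound C k (n%:R `^ (2 + omega R) * d%:R) t%:R
      & 1 - 2 ^ (1 - d%:Z) * n%:R ^+ 3
          <= output_prob R (T d) p d M L (permanent M)].
Proof.
have [K HK] := permanent_program_ok; exists permanent_program => T [C [k TO]].
have [C' [k' H]] := time_softO K TO.
(* The tape has length [n], one element per evaluation point. *)
exists C', k' => n d g2 M n0 d0 sg irr; exists n, (K * n ^ 4 * unit_cost n (T d))%N; split.
- move=> r; have [t [s [ex le _]]] := HK n d (T d) g2 M r n0 (size_tuple r).
  by exists t, s.
- exact: H.
- pose A i j := nth 0 (entries M) (i * n + j).
  apply: le_trans (good_tuples_prob R A n0 d0 sg irr) _.
  rewrite /output_prob ler_wpM2r ?invr_ge0 ?ler0n // ler_nat; apply: subset_leq_card.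
  apply/fintype.subsetP => r; rewrite !inE => /andP[gr ur].
  exact: (permanent_program_correct (T d) n0 d0 sg irr (size_tuple r) ur gr).
Qed.
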